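(* Let $d,m\ge2$ and let $\boldsymbol{F}=(F_1,\ldots,F_m)$ be a system of polynomials in $\mathbb{Z}[X_1,\ldots,X_m]$ of degree at most $d$ and height at most $h$. Let $k\ge1$ and assume $\boldsymbol{F}$ has only finitely many periodic points of order $k$ in $\mathbb{C}^m$. Then there exists an integer $\mathfrak{A}_k\ge1$ with $$\log\mathfrak{A}_k\ll_{d,h,m}d^{k(3m+2)}$$ such that, for every prime $p$ not dividing $\mathfrak{A}_k$, the reduction of $\boldsymbol{F}$ modulo $p$ has at most $d^{km}$ periodic points of order $k$ in $\overline{\mathbb{F}}_p^{\,m}$.
   Context: $\mathrm{h}(F)$ is the logarithm of the maximum absolute value of the coefficients of $F$. Iterates: $F_i^{(0)}=X_i$, $F_i^{(n)}=F_i(F_1^{(n-1)},\ldots,F_m^{(n-1)})$. A point $\boldsymbol{w}$ is periodic of order $k$ for a polynomial system $\boldsymbol{G}$ if $\boldsymbol{G}^{(k)}(\boldsymbol{w})=\boldsymbol{w}$ ($k$ need not be minimal). The notation $\ll_{d,h,m}$ means the implied constant depends only on $d,h,m$. *)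

(* Defs.v *)
From mathcomp Require Import all_boot all_order all_algebra.
From mathcomp Require Import complex mpoly.
From mathcomp Require Import classical_sets cardinality reals exp.

Set Implicit Arguments.
Unset Strict Implicit.
Unset Printing Implicit Defensive.

Import Order.TTheory GRing.Theory Num.Theory.
Local Open Scope ring_scope.

Definition poly_system (m : nat) (R : comNzRingType) := m.-tuple {mpoly R[m]}.

Fixpoint iter_sys (m : nat) (R : comNzRingType) (F : poly_system m R) (n : nat)
    : poly_system m R :=
  if n is n'.+1 then [tuple tnth F i \mPo iter_sys F n' | i < m]
  else [tuple 'X_i | i < m].

(* The order k is not required to be minimal. *)
Definition periodic_points (m : nat) (R : comNzRingType) (F : poly_system m R)
    (k : nat) : set (m.-tuple R) :=
  [set w | [tuple (tnth (iter_sys F k) i).@[tnth w] | i < m] = w].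

Definition map_sys (m : nat) (R S : comNzRingType) (f : {rmorphism R -> S})
    (F : poly_system m R) : poly_system m S :=
  [tuple map_mpoly f (tnth F i) | i < m].

Definition complex_sys (R : rcfType) (m : nat) (F : poly_system m int)
    : poly_system m R[i] :=
  map_sys (intmul 1 : {rmorphism int -> R[i]}) F.

(* 'F_p is the field with p elements only when p is prime. *)
Definition reduce_sys (p m : nat) (F : poly_system m int)
    : poly_system m 'F_p :=
  map_sys (intmul 1 : {rmorphism int -> 'F_p}) F.

(* msize is the total degree plus 1 for nonzero polynomials, and 0 for 0. *)
Definition degree_le (m : nat) (R : comNzRingType) (F : poly_system m R)
    (d : nat) : Prop :=
  forall i : 'I_m, (msize (tnth F i) <= d.+1)%N.

(* ln 0 = 0, so the zero polynomial has height 0. *)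
Definition height (R : realType) (m : nat) (P : {mpoly int[m]}) : R :=
  ln (\max_(u <- msupp P) `|P@_u|%N)%:R.

Definition height_le (R : realType) (m : nat) (F : poly_system m int) (h : R)
    : Prop :=
  forall i : 'I_m, height R (tnth F i) <= h.

(* Every element of the closed field K is a root of a monic polynomial over k;
   such a K exists by countable_algebraic_closure when k is countable. *)
Definition is_alg_closure (k : fieldType) (K : closedFieldType)
    (iota : {rmorphism k -> K}) : Prop := integralRange iota.

(* Main.v *)
(* Put D = d^k and G_i = F_i^(k) - X_i, and introduce indeterminates a_ij, z and
     Y_i = z G_i + x_i^D + sum_j a_ij x_j,   T = x_0 + sum_j a_mj x_j.
   The m + 1 polynomials Y_i, T in m variables x are algebraically dependent over
   Z[a, z]; Macaulay's determinant gives an explicit relation R(Y, T, z) = 0 of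
   degree at most D^m in T with small coefficients.  If G has finitely many
   complex zeros, a polynomial in each x_j lies in the ideal (G) over Q by the
   Nullstellensatz, and then z s(T) is integral over Z[a][Y, T] for some
   s over Z[a] in one variable: this is a second relation S(Y, T, z) = 0
   whose leading coefficient in z only involves T.  The greatest
   common divisor E of R and S, taken in a factorial ring, is again a relation.
   Its leading coefficient e in z divides that of S, hence only involves T, and
   that of R, call it r.  Comparing leading terms in z in E(Y, T, z) = 0 at a zero
   v of G modulo p shows that T(v) is a root of e.  The linear forms T(v) are
   distinct for distinct v, so there are at most deg_T r <= D^m zeros unless p
   divides r.  Any nonzero integer coefficient of r can therefore serve as the
   number A_k. *)

From HB Require Import structures.
Require Import Defs.
From mathcomp Require Import all_boot all_fingroup all_order all_algebra.
From mathcomp Require Import complex.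
From mathcomp Require Import classical_sets cardinality reals exp.
From mathcomp Require Import generic_quotient ring_quotient mpoly finmap boolp sequences.
From mathcomp Require Import zify ring.

Set Implicit Arguments.
Unset Strict Implicit.
Unset Printing Implicit Defensive.

Import Order.TTheory GRing.Theory Num.Theory.
Local Open Scope ring_scope.

(** At infinity or modulo p the zeros of [G] may have positive dimension, and then an elimination
    polynomial built from [G] alone vanishes identically. The terms x_i^D prevent this: at z = 0, a
    = 0 the forms become x_i^D and x_0, and Macaulay's determinant stays nonzero there. Each of the
    two relations lacks what the other has. R has small coefficients and small degree in T, but its
    leading coefficient in z may involve the Y_i, whose values vary with v, so it does not bound the
    number of zeros. S has a leading coefficient in T alone, but of unknown size, since S comes from
    the Nullstellensatz and from integral closure. A common factor E inherits both virtues. It is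
    again a relation by a Bezout identity d E = u S + v R with d free of Y_0, because the other Y_i,
    T and z are algebraically independent. T contains x_0 for the sake of this independence, as a
    substitute for Y_0. The determinant has at most (m D)^m rows, with entries of logarithmic size
    O(D), so that log A_k is of order D^(m+1). *)

(** * Ring morphisms compared on generators *)

Lemma poly_hom_ext (R S : nzRingType) (f g : {rmorphism {poly R} -> S}) :
  (forall c, f c%:P = g c%:P) -> f 'X = g 'X -> f =1 g.
Proof.
move=> eqC eqX p; rewrite -[p]coefK poly_def !rmorph_sum.
by apply: eq_bigr => i _; rewrite -mul_polyC !rmorphM !rmorphXn /= eqC eqX.
Qed.

Lemma mpoly_hom_ext n (R S : nzRingType) (f g : {rmorphism {mpoly R[n]} -> S}) :
  (forall c, f c%:MP = g c%:MP) -> (forall i, f 'X_i = g 'X_i) -> f =1 g.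
Proof.
move=> eqC eqX p; rewrite [p]mpolyE !rmorph_sum.
apply: eq_bigr => m _; rewrite -mul_mpolyC mpolyXE_id !rmorphM !rmorph_prod eqC.
by congr (_ * _); apply: eq_bigr => i _; rewrite !rmorphXn eqX.
Qed.

Lemma int_hom_ext (S : nzRingType) (f g : {rmorphism int -> S}) : f =1 g.
Proof. by move=> z; rewrite -[z]intz !rmorph_int. Qed.

Lemma mmapXU n (R S : nzRingType) (f : {rmorphism R -> S}) (h : 'I_n -> S) i :
  mmap f h 'X_i = h i.
Proof. by rewrite /mmap msuppX big_seq1 mcoeffX eqxx rmorph1 mul1r mmap1U. Qed.

(** * Polynomials in one and in several variables *)

Section Split.
Variables (n : nat) (R : comNzRingType).

Definition on_cons (A : Type) (a : A) (h : 'I_n -> A) (i : 'I_n.+1) : A :=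
  if unlift ord0 i is Some j then h j else a.

Lemma on_cons0 A (a : A) h : on_cons a h ord0 = a.
Proof. by rewrite /on_cons unlift_none. Qed.

Lemma on_consS A (a : A) h j : on_cons a h (lift ord0 j) = h j.
Proof. by rewrite /on_cons liftK. Qed.

Definition mhead : {mpoly R[n.+1]} -> {poly {mpoly R[n]}} :=
  mmap (polyC \o @mpolyC n R) (on_cons 'X (fun j => ('X_j)%:P)).

HB.instance Definition _ := GRing.RMorphism.on mhead.

Definition munhead : {poly {mpoly R[n]}} -> {mpoly R[n.+1]} :=
  horner_eval 'X_ord0 \o
  map_poly (mmap (@mpolyC n.+1 R) (fun j : 'I_n => 'X_(lift ord0 j))).

HB.instance Definition _ := GRing.RMorphism.on munhead.

Lemma mheadC c : mhead c%:MP = c%:MP%:P.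
Proof. by rewrite /mhead mmapC. Qed.
Lemma mhead0 : mhead 'X_ord0 = 'X.
Proof. by rewrite /mhead mmapXU on_cons0. Qed.
Lemma mheadS j : mhead 'X_(lift ord0 j) = ('X_j)%:P.
Proof. by rewrite /mhead mmapXU on_consS. Qed.

Lemma munheadX : munhead 'X = 'X_ord0.
Proof. by rewrite /munhead /= map_polyX /horner_eval hornerX. Qed.
Lemma munheadC p : munhead p%:P = mmap (@mpolyC n.+1 R) (fun j : 'I_n => 'X_(lift ord0 j)) p.
Proof. by rewrite /munhead /= map_polyC /horner_eval hornerC. Qed.

Lemma mheadK : cancel mhead munhead.
Proof.
apply: (mpoly_hom_ext (f := munhead \o mhead) (g := idfun)) => [c|i] /=.
  by rewrite mheadC munheadC mmapC.
case: (unliftP ord0 i) => [j|] ->; last by rewrite mhead0 munheadX.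
by rewrite mheadS munheadC mmapXU.
Qed.

Lemma mhead_eq0 p : (mhead p == 0) = (p == 0).
Proof. by rewrite -(inj_eq (can_inj mheadK)) rmorph0. Qed.

Lemma munheadK : cancel munhead mhead.
Proof.
apply: (poly_hom_ext (f := mhead \o munhead) (g := idfun)) => [c|] /=; last first.
  by rewrite munheadX mhead0.
rewrite munheadC.
apply: (mpoly_hom_ext (f := mhead \o (mmap (@mpolyC n.+1 R) _))
          (g := polyC)) => [d|i] /=.
  by rewrite mmapC mheadC.
by rewrite mmapXU mheadS.
Qed.

Lemma meval_mhead x (h : 'I_n -> R) p :
  p.@[on_cons x h] = (map_poly (meval h) (mhead p)).[x].
Proof.
apply: (mpoly_hom_ext (f := meval (on_cons x h))
   (g := horner_eval x \o map_poly (meval h) \o mhead)) => [c|i] /=.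
  by rewrite mheadC map_polyC /= /horner_eval hornerC !mevalC.
rewrite mevalXU; case: (unliftP ord0 i) => [j|] ->.
  by rewrite mheadS on_consS map_polyC /= /horner_eval hornerC mevalXU.
by rewrite mhead0 on_cons0 map_polyX /horner_eval hornerX.
Qed.

End Split.

Lemma inj_nonroot (A : idomainType) (s : nat -> A) (p : {poly A}) :
  injective s -> p != 0 -> exists N, p.[s N] != 0.
Proof.
move=> s_inj p_neq0.
case: (boolP (all (fun i => root p (s i)) (iota 0 (size p)))) => [allr|]; last first.
  by case/allPn => i _ nr; exists i.
have := max_poly_roots p_neq0 (rs := [seq s i | i <- iota 0 (size p)]).
rewrite all_map map_inj_uniq // iota_uniq size_map size_iota ltnn.
by move/(_ allr isT).
Qed.

(** Each variable has its own sequence of test points because [degenerate_inj] needs D-th powers for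
    some variables and all naturals for the others. *)
Lemma mpoly_nonroot (A : idomainType) n (s : 'I_n -> nat -> A) (p : {mpoly A[n]}) :
  (forall i, injective (s i)) -> p != 0 ->
  exists N : 'I_n -> nat, p.@[fun i => s i (N i)] != 0.
Proof.
elim: n s p => [|n IHn] s p s_inj p_neq0.
  exists (fun=> 0%N); rewrite (nvar0_mpolyC p) mevalC.
  by rewrite (nvar0_mpolyC p) mpolyC_eq0 in p_neq0.
have q_neq0 : mhead p != 0 by rewrite mhead_eq0.
have [||N Nne0] := IHn (fun i => s (lift ord0 i)) (lead_coef (mhead p)).
- by move=> i; apply: s_inj.
- by rewrite lead_coef_eq0.
set h := (fun i => _) in Nne0.
have [||k kne0] := @inj_nonroot A (s ord0) (map_poly (meval h) (mhead p)).
- exact: s_inj.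
- by rewrite map_poly_eq0_id0.
exists (on_cons k N); rewrite (meval_eq (v2 := on_cons (s ord0 k) h)) ?meval_mhead //.
by move=> i; case: (unliftP ord0 i) => [j|] ->; rewrite !(on_cons0, on_consS).
Qed.

Section TopCoef.
Variable R : comNzRingType.

(* The top coefficient [c] may vanish. *)
Definition has_top (d : nat) (p : {poly R}) (c : R) :=
  (size p <= d.+1)%N /\ p`_d = c.

Lemma has_topM d e p q a b :
  has_top d p a -> has_top e q b -> has_top (d + e) (p * q) (a * b).
Proof.
move=> [sp <-] [sq <-]; split.
  apply: leq_trans (size_polyMleq _ _) _.
  by rewrite -subn1 leq_subLR add1n -addSn -addnS leq_add.
rewrite coefM (bigD1 (Ordinal (leq_addr e d : (d < (d + e).+1)%N))) //=.
rewrite addKn big1 ?addr0 // => i; rewrite -val_eqE /= => ne_id.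
have [lt_id|] := ltnP i d; last first.
  move=> le_di; rewrite [p`_i]nth_default ?mul0r //.
  by apply: leq_trans sp _; rewrite ltn_neqAle eq_sym ne_id.
rewrite [q`_ _]nth_default ?mulr0 //; apply: leq_trans sq _.
by rewrite ltn_subRL ltn_add2r.
Qed.

Lemma has_top1 : has_top 0 1 1.
Proof. by split; rewrite ?size_poly1 // coef1. Qed.

Lemma has_topX d p a k : has_top d p a -> has_top (d * k) (p ^+ k) (a ^+ k).
Proof.
move=> hp; elim: k => [|k IHk]; first by rewrite muln0 !expr0; apply: has_top1.
by rewrite mulnS !exprS; apply: has_topM.
Qed.

Lemma has_top_prod (I : Type) (r : seq I) (d : I -> nat) (p : I -> {poly R}) a :
  (forall i, has_top (d i) (p i) (a i)) ->
  has_top (\sum_(i <- r) d i) (\prod_(i <- r) p i) (\prod_(i <- r) a i).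
Proof.
move=> h; elim: r => [|i r IHr]; first by rewrite !big_nil; apply: has_top1.
by rewrite !big_cons; apply: has_topM.
Qed.

End TopCoef.

Section Shear.
Variables (A : idomainType) (n : nat).

(** The change of coordinates of Noether normalisation, x_j to x_j + t_j x_0, read as a polynomial
    in x_0. *)
Definition shear (t : 'I_n -> nat) : {mpoly A[n.+1]} -> {poly {mpoly A[n]}} :=
  mmap (polyC \o @mpolyC n A) (on_cons 'X (fun j => ('X_j)%:P + 'X *+ t j)).

HB.instance Definition _ t := GRing.RMorphism.on (shear t).

(** With d the total degree, the coefficient of 'X^d after shearing is the top form of [f] at (1,
    t). Putting x_0 = 1 loses no monomial of that form, since the degree d recovers the exponent of
    x_0; hence some [t] gives a nonzero value. *)
Lemma shear_monic (f : {mpoly A[n.+1]}) :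
  injective (fun k : nat => k%:R : A) -> f != 0 ->
  exists t c, c != 0 /\ lead_coef (shear t f) = c%:MP.
Proof.
move=> natA_inj f_neq0; set d := (msize f).-1.
pose tl (m : 'X_{1..n.+1}) : 'X_{1..n} := [multinom m (lift ord0 j) | j < n].
have deg_tl m : mdeg m = (m ord0 + mdeg (tl m))%N.
  by rewrite !mdegE big_ord_recl; congr addn; apply: eq_bigr => j _; rewrite mnmE.
pose q := \sum_(m <- msupp f | mdeg m == d) f@_m *: 'X_[tl m] : {mpoly A[n]}.
have q_neq0 : q != 0.
  apply/negP => /eqP /(congr1 (mcoeff (tl (mlead f)))) /eqP.
  have dl : mdeg (mlead f) = d by rewrite /d -mlead_deg.
  rewrite mcoeff0 raddf_sum /= big_mkcond.
  rewrite (bigD1_seq (mlead f)) ?msupp_uniq ?mlead_supp //= dl eqxx.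
  rewrite mcoeffZ mcoeffX eqxx mulr1 big1 ?addr0 ?mleadc_eq0 ?(negbTE f_neq0) //.
  move=> m ne_m; case: eqP => // dm; rewrite mcoeffZ mcoeffX; case: eqP => [e|]; rewrite ?mulr0 //.
  case/negP: ne_m; apply/eqP/mnmP => i.
  case: (unliftP ord0 i) => [j|] ->.
    by move/mnmP/(_ j): e; rewrite !mnmE.
  by move: dm; rewrite -dl (deg_tl m) (deg_tl (mlead f)) e => /addIn.
have [|t qt_neq0] := mpoly_nonroot (s := fun _ k => k%:R) _ q_neq0 => //.
exists t, q.@[fun i => (t i)%:R]; split=> //.
have topm m : has_top (mdeg m) (mmap1 (on_cons ('X : {poly {mpoly A[n]}}) (fun j => ('X_j)%:P + 'X *+ t j)) m)
    (('X_[tl m] : {mpoly A[n]}).@[fun i => (t i)%:R])%:MP_[n].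
  rewrite deg_tl mdegE /mmap1 big_ord_recl on_cons0 -[_%:MP]mul1r.
  apply: has_topM.
    have topX : has_top 1 ('X : {poly {mpoly A[n]}}) 1 by split; rewrite ?size_polyX ?coefX.
    have := has_topX (m ord0) topX; rewrite mul1n expr1n; apply.
  rewrite mevalX rmorph_prod /=; apply: has_top_prod => i.
  rewrite on_consS !mnmE rmorphXn /=.
  have topL : has_top 1 (('X_i)%:P + 'X *+ t i : {poly {mpoly A[n]}}) (t i)%:R%:MP; last first.
    by have := has_topX (m (lift ord0 i)) topL; rewrite mul1n.
  split; last by rewrite coefD coefC coefMn coefX add0r mpolyC_nat.
  apply: leq_trans (size_polyD _ _) _; rewrite geq_max (leq_trans (size_polyC_leq1 _)) //=.
  by apply/leq_sizeP => k ltk; rewrite coefMn coefX gtn_eqF ?mul0rn.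
have top : has_top d (shear t f) (q.@[fun i => (t i)%:R])%:MP.
  have le_m m : m \in msupp f -> (mdeg m <= d)%N.
    by move=> mf; rewrite -ltnS /d prednK ?msize_mdeg_lt // lt0n msize_poly_eq0.
  split.
    apply: leq_trans (size_sum _ _ _) _; apply/bigmax_leqP_seq => m /le_m le_md _.
    rewrite /= mul_polyC (leq_trans (size_scale_leq _ _)) //.
    by apply: leq_trans (topm m).1 _.
  have -> : q.@[fun i => (t i)%:R] = \sum_(m <- msupp f | mdeg m == d)
      f@_m * ('X_[tl m] : {mpoly A[n]}).@[fun i => (t i)%:R].
    by rewrite /q raddf_sum /=; apply: eq_bigr => m _; rewrite mevalZ.
  rewrite /shear /mmap coef_sum rmorph_sum /= big_seq [RHS]big_seq_cond.
  rewrite [LHS](bigID (fun m => mdeg m == d)) /= [X in _ + X]big1 ?addr0.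
        apply: eq_bigr => m /andP [_ /eqP <-].
    by rewrite coefCM (topm m).2 rmorphM.
  move=> m /andP [/le_m le_md ne_md]; rewrite coefCM nth_default ?mulr0 //.
  by apply: leq_trans (topm m).1 _; rewrite ltn_neqAle ne_md.
have nz : (q.@[fun i => (t i)%:R])%:MP_[n] != 0 by rewrite mpolyC_eq0.
rewrite lead_coefE; suff -> : (size (shear t f)).-1 = d by exact: top.2.
suff -> : size (shear t f) = d.+1 by [].
apply/eqP; rewrite eqn_leq top.1 /= ltnNge; apply/negP => le_d.
by move: nz; rewrite -top.2 nth_default ?eqxx.
Qed.

End Shear.

(** * Algebraic dependence by counting monomials *)

Lemma card_bmultinom n E : (#|{: 'X_{1..n < E}}| <= E ^ n)%N.
Proof.
case: E => [|E].
  rewrite (_ : #|_| = 0)%N //; apply: eq_card0 => m.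
  by have := bmdeg m.
pose g (m : 'X_{1..n < E.+1}) : {ffun 'I_n -> 'I_E.+1} := [ffun i => inord (m i)].
have mi (m : 'X_{1..n < E.+1}) i : (m i < E.+1)%N.
  by apply: leq_ltn_trans (bmdeg m); rewrite mdegE (bigD1 i) //= leq_addr.
have g_inj : injective g.
  move=> m1 m2 /ffunP eqg; apply/eqP; rewrite bmeqP; apply/eqP/mnmP => i.
  by have := eqg i; rewrite !ffunE => /(congr1 val); rewrite /= !inordK.
by have := leq_card g g_inj; rewrite card_ffun !card_ord.
Qed.

Lemma linear_dependency (A : idomainType) (T U : finType) (M : T -> U -> A) :
  (#|U| < #|T|)%N ->
  exists v : T -> A, (exists t, v t != 0) /\ forall u, \sum_t v t * M t u = 0.
Proof.
move=> ltUT.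
(* Zero columns pad the matrix to a square one of determinant zero, so that [det0P] yields a kernel
   vector with entries in [A] itself. *)
pose B := \matrix_(i < #|T|, j < #|T|)
   (if insub (val j) is Some k then M (enum_val i) (enum_val (k : 'I_#|U|)) else 0).
have detB : \det B = 0.
  rewrite (expand_det_col B (Ordinal ltUT)) big1 // => i _.
  by rewrite mxE /= insubF ?mul0r // ltnn.
have [|v v_neq0 vB] := det0P (A := B) _; first exact/eqP.
exists (fun t => v 0 (enum_rank t)); split.
  have /rV0Pn [i vi] := v_neq0; exists (enum_val i); by rewrite enum_valK.
move=> u; have lt_u : (enum_rank u < #|T|)%N by apply: ltn_trans ltUT.
have := congr1 (fun w : 'rV_ _ => w 0 (Ordinal lt_u)) vB; rewrite !mxE => vBu.
rewrite -[RHS]vBu (reindex (@enum_rank T)) /=; last first.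
  by apply: onW_bij; exists enum_val; [apply: enum_rankK | apply: enum_valK].
by apply: eq_bigr => t _; rewrite mxE /= valK !enum_rankK.
Qed.

Lemma msizeM_leq n (R : idomainType) (p q : {mpoly R[n]}) :
  (msize (p * q) <= (msize p + msize q).-1)%N.
Proof.
have [->|p0] := eqVneq p 0; first by rewrite mul0r msize0.
have [->|q0] := eqVneq q 0; first by rewrite mulr0 msize0.
by rewrite msizeM.
Qed.

(** There are (N+1)^(n+1) monomials with exponents at most N, and their values lie in degree below
    E, hence in a space with at most E^n monomials. As E <= c' (N+1), the choice N = c'^n gives E^n
    <= N (N+1)^n < (N+1)^(n+1). *)
Lemma algebraic_relation (A : idomainType) n (p : 'I_n.+1 -> {mpoly A[n]}) :
  exists f : {mpoly A[n.+1]}, f != 0 /\ mmap (@mpolyC n A) p f = 0.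
Proof.
pose c := (\sum_i msize (p i)).+1; pose c' := (n.+1 * c).+1; pose N := (c' ^ n)%N.
pose E := (n.+1 * (c * N)).+1.
pose mon (a : {ffun 'I_n.+1 -> 'I_N.+1}) : 'X_{1..n.+1} := [multinom val (a i) | i < n.+1].
have le_c i : (msize (p i) <= c)%N.
  by rewrite /c (bigD1 i) //= -addSn (leq_trans _ (leq_addr _ _)).
have szp i k : (msize (p i ^+ k) <= (c * k).+1)%N.
  elim: k => [|k IHk]; first by rewrite expr0 msize1.
  rewrite exprS (leq_trans (msizeM_leq _ _)) // mulnS -ltnS.
  by apply: leq_ltn_trans (leq_pred _) _; rewrite ltnS -addnS leq_add.
have szm a : (msize (mmap1 p (mon a)) <= E)%N.
  rewrite /mmap1.
  suff: (msize (\prod_i p i ^+ mon a i) <= (\sum_(i < n.+1) c * N).+1)%N.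
    by rewrite sum_nat_const card_ord.
  elim/big_rec2: _ => [|i s q _ IH]; first by rewrite msize1.
  apply: leq_trans (msizeM_leq _ _) _.
  rewrite -ltnS -subn1 ltnS leq_subLR add1n -addSn -addnS leq_add //.
  apply: leq_trans (szp _ _) _; rewrite ltnS leq_mul2l mnmE.
  by rewrite -ltnS ltn_ord orbT.
have [|v [[a0 v0] vE]] := @linear_dependency A {ffun 'I_n.+1 -> 'I_N.+1} 'X_{1..n < E}
   (fun a m => (mmap1 p (mon a))@_m).
  apply: leq_ltn_trans (card_bmultinom _ _) _; rewrite card_ffun !card_ord.
  have leE : (E <= c' * N.+1)%N.
    have le_mulS a b : ((a * b).+1 <= a.+1 * b.+1)%N.
      by rewrite mulSn addSn ltnS (leq_trans _ (leq_addl _ _)) // leq_mul.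
    by rewrite /E mulnA le_mulS.
  apply: leq_ltn_trans (_ : (c' * N.+1) ^ n < _)%N; first by case: (n) => // n'; rewrite leq_exp2r.
  by rewrite expnMn expnS ltn_pmul2r ?expn_gt0.
exists (\sum_a v a *: 'X_[mon a]); split.
  apply/eqP => /(congr1 (mcoeff (mon a0))) /eqP.
  rewrite mcoeff0 raddf_sum (bigD1 a0) //= mcoeffZ mcoeffX eqxx mulr1 big1.
    by rewrite addr0 (negbTE v0).
  move=> a ne_a; rewrite mcoeffZ mcoeffX; case: eqP => [/mnmP e|]; rewrite ?mulr0 //.
  case/eqP: ne_a; apply/ffunP => i; apply: val_inj.
  by have := e i; rewrite !mnmE.
rewrite raddf_sum /=; apply/mpolyP => m; rewrite mcoeff0 raddf_sum /=.
under eq_bigr do rewrite mmapZ mmapX mcoeffCM.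
have [lt_m|le_m] := ltnP (mdeg m) E; first exact: (vE (BMultinom lt_m)).
rewrite big1 // => a _; rewrite [X in _ * X]memN_msupp_eq0 ?mulr0 //.
by apply: msize_mdeg_ge; apply: leq_trans (szm a) le_m.
Qed.

(** * Hilbert's Nullstellensatz over the integers *)

Record is_ideal (A : comNzRingType) (I : A -> Prop) : Prop := IsIdeal {
  ideal0 : I 0;
  idealD : forall a b, I a -> I b -> I (a + b);
  idealM : forall c a, I a -> I (c * a) }.

(** The two hypotheses keep both degrees, hence the size of the Sylvester matrix. *)
Lemma map_resultant_hom (A K : nzRingType) (f : {rmorphism A -> K}) p q :
  f (lead_coef p) != 0 -> f (lead_coef q) != 0 ->
  f (resultant p q) = resultant (map_poly f p) (map_poly f q).
Proof.
move=> nz_fp nz_fq; rewrite /resultant /Sylvester_mx !size_map_poly_id0 //.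
rewrite -det_map_mx /= map_col_mx; congr (\det (col_mx _ _));
  by apply: map_lin1_mx => v; rewrite map_poly_rV rmorphM /= map_rVpoly.
Qed.

Section Unshear.
Variables (A : idomainType) (n : nat) (t : 'I_n -> nat).

Definition unshear : {poly {mpoly A[n]}} -> {mpoly A[n.+1]} :=
  horner_eval 'X_ord0 \o map_poly (mmap (@mpolyC n.+1 A)
    (fun j : 'I_n => 'X_(lift ord0 j) - 'X_ord0 *+ t j)).

HB.instance Definition _ := GRing.RMorphism.on unshear.

Lemma unshearX : unshear 'X = 'X_ord0.
Proof. by rewrite /unshear /= map_polyX /horner_eval hornerX. Qed.

Lemma unshearC p : unshear p%:P =
  mmap (@mpolyC n.+1 A) (fun j : 'I_n => 'X_(lift ord0 j) - 'X_ord0 *+ t j) p.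
Proof. by rewrite /unshear /= map_polyC /horner_eval hornerC. Qed.

Lemma shearC c : shear t c%:MP = c%:MP%:P :> {poly {mpoly A[n]}}.
Proof. by rewrite /shear mmapC. Qed.

Lemma shear0 : shear t 'X_ord0 = 'X :> {poly {mpoly A[n]}}.
Proof. by rewrite /shear mmapXU on_cons0. Qed.

Lemma shearS j : shear t 'X_(lift ord0 j) = ('X_j)%:P + 'X *+ t j :> {poly {mpoly A[n]}}.
Proof. by rewrite /shear mmapXU on_consS. Qed.

Lemma shearK : cancel (@shear A n t) unshear.
Proof.
apply: (mpoly_hom_ext (f := unshear \o shear t) (g := idfun)) => [c|i] /=.
  by rewrite shearC unshearC mmapC.
case: (unliftP ord0 i) => [j|] ->; last by rewrite shear0 unshearX.
by rewrite shearS rmorphD rmorphMn /= unshearX unshearC mmapXU subrK.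
Qed.

Lemma unshearK : cancel unshear (@shear A n t).
Proof.
apply: (poly_hom_ext (f := shear t \o unshear) (g := idfun)) => [c|] /=; last first.
  by rewrite unshearX shear0.
rewrite unshearC.
apply: (mpoly_hom_ext (f := shear t \o mmap (@mpolyC n.+1 A) _) (g := polyC)) => [d|i] /=.
  by rewrite mmapC shearC.
by rewrite mmapXU rmorphB rmorphMn /= shearS shear0 addrK.
Qed.

Lemma meval_shear x (h : 'I_n -> A) p :
  p.@[on_cons x (fun j => h j + x *+ t j)] = (map_poly (meval h) (shear t p)).[x].
Proof.
apply: (mpoly_hom_ext (f := meval (on_cons x (fun j => h j + x *+ t j)))
   (g := horner_eval x \o map_poly (meval h) \o shear t)) => [c|i] /=.
  by rewrite shearC map_polyC /= /horner_eval hornerC !mevalC.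
rewrite mevalXU; case: (unliftP ord0 i) => [j|] ->.
  by rewrite shearS on_consS rmorphD rmorphMn /= map_polyC map_polyX
    /horner_eval hornerD hornerMn hornerC hornerX /= mevalXU.
by rewrite shear0 on_cons0 map_polyX /horner_eval hornerX.
Qed.

End Unshear.

(** A nonzero element of least degree generates the ideal and is not constant. It is found by
    descent, replacing [h0] by a nonzero remainder. *)
Lemma poly_ideal_root (K : closedFieldType) (J : {poly K} -> Prop) :
  is_ideal J -> ~ J 1 -> exists x, forall h, J h -> h.[x] = 0.
Proof.
move=> [J0 JD JM] J1.
have [allz|] := lem (forall h, J h -> h = 0).
  by exists 0 => h /allz ->; rewrite horner0.
move=> /existsNP [h0 /not_implyP [Jh0 /eqP h00]].
have [n] := ubnP (size h0); elim: n => // n IHn in h0 Jh0 h00 *; move=> szh.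
have [dv|] := lem (forall h, J h -> h0 %| h).
  have /closed_rootP [x /rootP hx] : size h0 != 1%N.
    apply/negP => /size_poly1P [c c0 hE]; apply: J1.
    suff -> : 1 = c^-1%:P * h0 by apply: JM.
    by rewrite hE -polyCM mulVf.
  by exists x => h /dv /dvdpP [q ->]; rewrite hornerM hx mulr0.
move=> /existsNP [h /not_implyP [Jh /negP ndv]].
apply: (IHn (h %% h0)).
- rewrite (_ : h %% h0 = h + (- (h %/ h0)) * h0); first exact: JD Jh (JM _ _ Jh0).
  by rewrite {2}(divp_eq h h0) mulNr addrAC subrr add0r.
- by apply: contra ndv => /eqP /modp_eq0P.
- by rewrite -ltnS; apply: leq_trans szh; rewrite ltnS ltn_modp.
Qed.

(** Extends a zero of the elimination ideal to one of [J]. The point is that the image of [J] under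
    [phi] stays proper: were [e] in [J] mapped to 1, the resultant of [e] and the monic [g] would
    lie in the elimination ideal, so [phi] would kill it, although 1 and the image of [g] have no
    common root. *)
Lemma ideal_root_lift (A : idomainType) (K : closedFieldType)
  (phi : {rmorphism A -> K}) (iota : {rmorphism K -> A}) (J : {poly A} -> Prop) g :
  cancel iota phi -> is_ideal J -> ~ J 1 -> J g -> g \is monic ->
  (forall a, J a%:P -> phi a = 0) ->
  exists x, forall e, J e -> (map_poly phi e).[x] = 0.
Proof.
move=> iotaK [J0 JD JM] J1 Jg g_monic Jphi.
have g0 : g != 0 := monic_neq0 g_monic.
have sg : (1 < size g)%N.
  rewrite ltn_neqAle size_poly_gt0 g0 andbT; apply/negP => /eqP sg.
  apply: J1; suff <- : g = 1 by [].
  have := size1_polyC (eq_leq (esym sg)) => gE.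
  by move/monicP: g_monic; rewrite gE lead_coefC => ->.
have gw_monic : map_poly phi g \is monic by apply: monic_map.
have [||x Jx] := @poly_ideal_root K (fun h => exists2 e, J e & map_poly phi e = h).
- split=> [|a b [a' Ja <-] [b' Jb <-]|a b [b' Jb <-]].
  + by exists 0; [exact: J0 | exact: raddf0].
  + by exists (a' + b'); [apply: JD | rewrite rmorphD].
  + exists (map_poly iota a * b'); first exact: JM.
    by rewrite rmorphM /=; congr (_ * _); rewrite -map_poly_comp map_poly_id // => u _ /=.
(* The degree of [e] may drop under [phi]. Adding a multiple of [g] of larger degree makes the
   leading coefficient 1 and changes no value at the roots of [g]. *)
- move=> [e Je e1]; pose N := size e; pose e' := e + g * 'X^N.
  have sgX : size (g * 'X^N) = (size g + N)%N.
    by rewrite size_mulXn // addnC.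
  have lt_eg : (size e < size (g * 'X^N)%R)%N.
    by rewrite sgX -[X in (X < _)%N]add0n ltn_add2r size_poly_gt0.
  have le' : lead_coef e' = 1.
    by rewrite /e' lead_coefDr // lead_coef_Mmonic ?monicXn // (monicP g_monic).
  have se' : (1 < size e')%N.
    by rewrite /e' addrC size_polyDl // sgX (leq_trans sg) ?leq_addr.
  have [[u v] /= _ resE] := resultant_in_ideal se' sg.
  have res0 : phi (resultant e' g) = 0.
    apply: Jphi; rewrite resE; apply: (JD); last exact: (JM).
    by apply: (JM); apply: (JD) => //; rewrite mulrC; apply: (JM).
  move: res0; rewrite map_resultant_hom /=; first last.
  + by rewrite (monicP g_monic) rmorph1 oner_eq0.
  + by rewrite le' rmorph1 oner_eq0.
  move/eqP; rewrite resultant_eq0 => sgcd.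
  have /closed_rootP [x] : size (gcdp (map_poly phi e') (map_poly phi g)) != 1%N by rewrite gtn_eqF.
  rewrite root_gcd => /andP [/rootP]; rewrite /e' rmorphD rmorphM /= e1 hornerD hornerM => + /rootP gx.
  by rewrite gx mul0r addr0 hornerC => /eqP; rewrite oner_eq0.
by exists x => e Je; apply: Jx; exists e.
Qed.

(** The induction step of the weak Nullstellensatz for an abstract [B] isomorphic to A[X] through
    [s]. The constant [c] is invertible in [K], so [s f] can be made monic. *)
Lemma ideal_zero_step (A B : idomainType) (K : closedFieldType) (W : Type)
  (phi : W -> {rmorphism A -> K}) (iota : {rmorphism K -> A})
  (s : {rmorphism B -> {poly A}}) (u : {rmorphism {poly A} -> B}) :
  (forall w, cancel iota (phi w)) -> cancel s u -> cancel u s ->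
  (forall I : A -> Prop, is_ideal I -> ~ I 1 ->
     exists w, forall a, I a -> phi w a = 0) ->
  forall (I : B -> Prop) f c, is_ideal I -> ~ I 1 -> I f ->
    c != 0 -> lead_coef (s f) = iota c ->
    exists w x, forall b, I b -> (map_poly (phi w) (s b)).[x] = 0.
Proof.
move=> iotaK sK uK IH I f c [I0 ID IM] I1 If c0 lf.
pose J g := I (u g).
have J0 : J 0 by rewrite /J rmorph0.
have JD a b : J a -> J b -> J (a + b) by rewrite /J rmorphD; apply: ID.
have JM a b : J b -> J (a * b) by rewrite /J rmorphM; apply: IM.
have J1 : ~ J 1 by rewrite /J rmorph1.
have J_ideal : is_ideal J by [].
pose g := (iota c^-1)%:P * s f.
have Jg : J g by apply: JM; rewrite /J sK.
have g_monic : g \is monic.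
  by rewrite monicE lead_coefM lead_coefC lf -rmorphM /= mulVf // rmorph1.
have [||w Jw] := IH (fun a => J a%:P).
- split=> [|a b Ja Jb|a b Jb]; first by rewrite polyC0.
    by rewrite polyCD; apply: JD.
  by rewrite polyCM; apply: JM.
- by rewrite polyC1.
have [x Jx] := ideal_root_lift (iotaK w) J_ideal J1 Jg g_monic Jw.
by exists w, x => b Ib; apply: Jx; rewrite /J sK.
Qed.

Lemma weak_nullstellensatz (K : closedFieldType) :
  injective (fun k : nat => k%:R : K) ->
  forall n (I : {mpoly K[n]} -> Prop), is_ideal I -> ~ I 1 ->
  exists w : 'I_n -> K, forall f, I f -> f.@[w] = 0.
Proof.
move=> natK; elim=> [|n IHn] I I_ideal I1.
  have [I0 ID IM] := I_ideal.
  exists (fun=> 0) => f If; rewrite (nvar0_mpolyC f) mevalC.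
  have [//|c0] := eqVneq (f@_0%MM) 0; case: I1.
  suff -> : 1 = (f@_0%MM)^-1%:MP * f by apply: IM.
  by rewrite {2}(nvar0_mpolyC f) -mpolyCM mulVf.
have [allz|] := lem (forall f, I f -> f = 0).
  by exists (fun=> 0) => f /allz ->; rewrite meval0.
move=> /existsNP [f0 /not_implyP [If0 /eqP f00]].
have [t [c [c0 lf0]]] := shear_monic natK f00.
have [w [x wx]] := @ideal_zero_step {mpoly K[n]} {mpoly K[n.+1]} K ('I_n -> K)
  (fun w => meval w) (@mpolyC n K) (@shear K n t) (@unshear K n t)
  (fun w c => mevalC w c) (@shearK K n t) (@unshearK K n t) IHn I f0 c I_ideal I1 If0 c0 lf0.
exists (on_cons x (fun j => w j + x *+ t j)) => f If.
by rewrite meval_shear; apply: wx.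
Qed.

Local Notation "x %:F" := (@FracField.tofrac _ x).

(** The extra generator [d] and the transport [s] serve the Rabinowitsch trick; with [s] the
    identity and [d] = 0 this is the plain ideal generated by the [c i]. *)
Lemma combination_ideal (B P : comNzRingType) (s : {rmorphism B -> P}) m (c : 'I_m -> P) d :
  is_ideal (fun b : B => exists q r, s b = \sum_i q i * c i + r * d).
Proof.
split.
- by exists (fun=> 0), 0; rewrite rmorph0 mul0r addr0 big1 // => i _; exact: mul0r.
- move=> a b [q [r aE]] [q' [r' bE]].
  exists (fun i => q i + q' i), (r + r'); rewrite rmorphD aE bE mulrDl addrACA.
  by congr (_ + _); rewrite -big_split; apply: eq_bigr => i _; rewrite mulrDl.
- move=> e a [q [r aE]]; exists (fun i => s e * q i), (s e * r).
  rewrite rmorphM aE mulrDr mulrA; congr (_ + _).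
  by rewrite big_distrr; apply: eq_bigr => i _; rewrite /= mulrA.
Qed.

Lemma combination_gen (P : comNzRingType) m (c : 'I_m -> P) d i :
  exists q r, c i = \sum_i q i * c i + r * d.
Proof.
exists (fun j => (j == i)%:R), 0; rewrite mul0r addr0 (bigD1 i) //= eqxx mul1r.
by rewrite big1 ?addr0 // => j /negbTE ->; rewrite mul0r.
Qed.

Lemma combination_last (P : comNzRingType) m (c : 'I_m -> P) d :
  exists q r, d = \sum_i q i * c i + r * d.
Proof.
exists (fun=> 0), 1; rewrite mul1r big1 ?add0r // => i _; exact: mul0r.
Qed.

(* Substitute ['X := 1 / f] and clear denominators. *)
Lemma rabinowitsch (A : idomainType) m (G : 'I_m -> A) (f : A) q r :
  f != 0 -> 1 = \sum_i q i * (G i)%:P + r * (1 - f%:P * 'X) ->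
  exists N (q' : 'I_m -> A), f ^+ N = \sum_i q' i * G i.
Proof.
move=> f0 e1; pose F : fieldType := {fraction A}.
have Ff0 : f%:F != 0 by rewrite tofrac_eq0.
have [phi [phiC phiX]] : exists phi : {rmorphism {poly A} -> F},
    (forall a, phi a%:P = a%:F) /\ phi 'X = (f%:F)^-1.
  exists (horner_eval (f%:F)^-1 \o map_poly (@FracField.tofrac A)); split=> [a|] /=.
    by rewrite map_polyC /= /horner_eval hornerC.
  by rewrite map_polyX /horner_eval hornerX.
have clearX (p : {poly A}) N : (size p <= N)%N -> exists b, f%:F ^+ N * phi p = b%:F.
  elim/poly_ind: p N => [|p c IHp] N.
    by move=> _; exists 0; rewrite !rmorph0 mulr0.
  rewrite size_MXaddC; case: ifP => [/andP [/eqP -> /eqP ->] _|_].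
    by exists 0; rewrite mul0r addr0 !rmorph0 mulr0.
  case: N => // N; rewrite ltnS => /IHp [b bE].
  exists (b + f ^+ N.+1 * c); rewrite !rmorphD !rmorphM rmorphXn mulrDr phiX phiC.
  by rewrite /= -bE; congr (_ + _); rewrite exprSr -mulrA; congr (_ * _); rewrite mulrC divfK.
pose N := \max_i size (q i).
have /choice [b bE] : forall i, exists b, f%:F ^+ N * phi (q i) = b%:F.
  by move=> i; apply: clearX; apply: leq_bigmax.
exists N, b; apply/eqP; rewrite -tofrac_eq rmorphXn rmorph_sum; apply/eqP => /=.
have := congr1 phi e1; rewrite rmorph1 rmorphD rmorphM rmorphB rmorph1 rmorphM phiC phiX.
rewrite divff // subrr mulr0 addr0 rmorph_sum => /(congr1 ( *%R (f%:F ^+ N))).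
rewrite mulr1 => ->; rewrite big_distrr; apply: eq_bigr => i _.
by rewrite /= !rmorphM /= -bE phiC mulrA.
Qed.

Lemma map_one_sub (A B : comNzRingType) (phi : {rmorphism A -> B}) f x :
  phi f = 0 -> (map_poly phi (1 - f%:P * 'X)).[x] = 1.
Proof.
by move=> f0; rewrite rmorphB rmorph1 rmorphM /= map_polyC map_polyX /= f0 mul0r subr0 hornerC.
Qed.

Section Nullstellensatz.
Variables (K : closedFieldType) (m : nat) (G : 'I_m -> {mpoly K[m]}).
Hypothesis natK : injective (fun k : nat => k%:R : K).

Lemma nullstellensatz (f : {mpoly K[m]}) : f != 0 ->
  (forall w, (forall i, (G i).@[w] = 0) -> f.@[w] = 0) ->
  exists N (q : 'I_m -> {mpoly K[m]}), f ^+ N = \sum_i q i * G i.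
Proof.
move=> f0 fz; pose d := 1 - f%:P * 'X : {poly {mpoly K[m]}}.
have I_ideal := combination_ideal (@mhead m K) (fun i => (G i)%:P) d.
set I := (fun b => _) in I_ideal.
have [[q [r]]|I1] := lem (I 1).
  by rewrite rmorph1; apply: rabinowitsch.
have [w wI] := weak_nullstellensatz natK I_ideal I1.
pose x := w ord0; pose h i := w (lift ord0 i).
have evI p : I (munhead p) -> (map_poly (meval h) p).[x] = 0.
  move=> /wI; rewrite (meval_eq (v2 := on_cons x h)) ?meval_mhead ?munheadK //.
  by move=> i; case: (unliftP ord0 i) => [j|] ->; rewrite ?on_cons0 ?on_consS.
have Gz i : (G i).@[h] = 0.
  have Ii : I (munhead (G i)%:P) by rewrite /I /= munheadK; apply: combination_gen.
  by have := evI _ Ii; rewrite map_polyC hornerC.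
have Id : I (munhead d) by rewrite /I /= munheadK; apply: combination_last.
have e1 := @map_one_sub {mpoly K[m]} K (meval h) f x (fz h Gz).
have /eqP : 1 = 0 :> K := etrans (esym e1) (evI d Id).
by rewrite oner_eq0.
Qed.

End Nullstellensatz.

(** * Descent of linear relations to the integers *)

Lemma common_denominator (I : finType) (x : I -> rat) :
  exists (d : int) (z : I -> int), d != 0 /\ forall i, d%:~R * x i = (z i)%:~R.
Proof.
exists (\prod_i denq (x i)), (fun i => numq (x i) * \prod_(j | j != i) denq (x j)).
split=> [|i]; first by apply/prodf_neq0 => i _; rewrite denq_neq0.
rewrite (bigD1 i) //= !rmorphM /= mulrAC; congr (_ * _).
by rewrite numqE mulrC.
Qed.

(** The kernel of a rational matrix over [K] is spanned by its rational kernel. If a [K]-vector in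
    it is nonzero at [t0], so is some rational basis vector; clearing denominators makes it
    integral. *)
Lemma kernel_descent (K : numFieldType) (T U : finType) (M : T -> U -> int)
  (v : T -> K) t0 :
  (forall u, \sum_t v t * (M t u)%:~R = 0) -> v t0 != 0 ->
  exists w : T -> int, w t0 != 0 /\ forall u, \sum_t w t * M t u = 0.
Proof.
move=> vM vt0.
pose Mq := \matrix_(i < #|T|, j < #|U|) (M (enum_val i) (enum_val j))%:~R : 'M[rat]_(#|T|, #|U|).
have sumT (R : zmodType) (F : T -> R) : \sum_t F t = \sum_(i < #|T|) F (enum_val i).
  by rewrite (reindex (@enum_val T predT)) //; apply: onW_bij; apply: enum_val_bij.
pose vr := \row_(i < #|T|) v (enum_val i) : 'rV[K]_#|T|.
have vK : (vr <= map_mx (@ratr K) (kermx Mq))%MS.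
  rewrite map_kermx; apply/sub_kermxP/rowP => j; rewrite !mxE -[RHS](vM (enum_val j)) sumT.
  by apply: eq_bigr => i _; rewrite !mxE rmorph_int.
have [i kij] : exists i, kermx Mq i (enum_rank t0) != 0.
  apply: contrapT => /forallNP nk; case/negP: vt0.
  have /submxP [D vD] := vK; have := congr1 (fun r : 'rV_ _ => r 0 (enum_rank t0)) vD.
  rewrite !mxE enum_rankK => ->; rewrite big1 // => i _.
  by rewrite mxE (eqP (negbNE (introT negP (nk i)))) rmorph0 mulr0.
have [d [z [d0 zE]]] := common_denominator (fun j => kermx Mq i j).
exists (fun t => z (enum_rank t)); split.
  by rewrite -(intr_eq0 rat) -zE mulf_neq0 // intr_eq0.
move=> u; apply/eqP; rewrite -(intr_eq0 rat) rmorph_sum sumT /=.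
have := congr1 (fun A : 'M_(_, _) => A i (enum_rank u)) (mulmx_ker Mq).
rewrite !mxE => kM; rewrite -[X in _ == X](mulr0 d%:~R) -{2}kM big_distrr /=.
by apply/eqP/eq_bigr => j _; rewrite rmorphM /= enum_valK -zE !mxE enum_rankK mulrA.
Qed.

Lemma mpoly_relation_descent (K : numFieldType) n (T : finType)
  (r : T -> {mpoly int[n]}) (v : T -> K) t0 :
  \sum_t v t *: map_mpoly intr (r t) = 0 -> v t0 != 0 ->
  exists w : T -> int, w t0 != 0 /\ \sum_t w t *: r t = 0.
Proof.
move=> vr vt0; pose E := \max_t msize (r t).
have [|w [wt0 wr]] := @kernel_descent K T 'X_{1..n < E} (fun t u => (r t)@_u) v t0 _ vt0.
  move=> u; have := congr1 (mcoeff u) vr; rewrite mcoeff0 raddf_sum /= => vru; rewrite -[RHS]vru.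
  by apply: eq_bigr => t _; rewrite mcoeffZ mcoeff_map_mpoly.
exists w; split=> //; apply/mpolyP => u; rewrite mcoeff0 raddf_sum /=.
have [lt_u|le_u] := ltnP (mdeg u) E.
  by rewrite -[RHS](wr (BMultinom lt_u)); apply: eq_bigr => t _; rewrite mcoeffZ.
rewrite big1 // => t _; rewrite mcoeffZ memN_msupp_eq0 ?mulr0 //.
by apply: msize_mdeg_ge; apply: leq_trans le_u; apply: leq_bigmax.
Qed.

Lemma sum_pair (R : nmodType) (I J : finType) (F : I * J -> R) :
  \sum_t F t = \sum_i \sum_j F (i, j).
Proof. by rewrite pair_bigA; apply: eq_bigr => -[]. Qed.

Definition poly_at n (R : comNzRingType) (x : {mpoly R[n]}) (p : {poly R}) : {mpoly R[n]} :=
  (map_poly (@mpolyC n R) p).[x].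

Lemma poly_at_sum n (R : comNzRingType) (x : {mpoly R[n]}) (p : {poly R}) N : (size p <= N)%N ->
  poly_at x p = \sum_(k < N) p`_k *: x ^+ k.
Proof.
move=> sp; rewrite /poly_at (@horner_coef_wide _ N); last first.
  by apply: leq_trans sp; apply: size_poly.
by apply: eq_bigr => k _; rewrite coef_map /= mul_mpolyC.
Qed.

Lemma mpoly_mul_sum n (R : comNzRingType) (p g : {mpoly R[n]}) N : (msize p <= N)%N ->
  p * g = \sum_(u : 'X_{1..n < N}) p@_u *: ('X_[u] * g).
Proof.
move=> sp; rewrite {1}(mpolywE sp) big_distrl /=.
by apply: eq_bigr => u _; rewrite scalerAl.
Qed.

(** Membership is a linear relation between the powers of 'X_j and the products 'X_[u] * G_i, all of
    which have integer coefficients. The coordinate kept nonzero in the descent is the leading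
    coefficient of [psi], whence psi' != 0. *)
Lemma membership_descent (K : numFieldType) m (G : 'I_m -> {mpoly int[m]}) j
  (psi : {poly K}) (q : 'I_m -> {mpoly K[m]}) :
  psi != 0 -> poly_at 'X_j psi = \sum_i q i * map_mpoly intr (G i) ->
  exists (psi' : {poly int}) (q' : 'I_m -> {mpoly int[m]}),
    psi' != 0 /\ poly_at 'X_j psi' = \sum_i q' i * G i.
Proof.
move=> psi0 e; pose N := (size psi + \max_i msize (q i))%N.
have sq i : (msize (q i) <= N)%N by rewrite (leq_trans _ (leq_addl _ _)) // leq_bigmax.
pose r (t : 'I_N + 'I_m * 'X_{1..m < N}) : {mpoly int[m]} :=
  match t with inl k => 'X_j ^+ k | inr (i, u) => 'X_[u] * G i end.
pose v (t : 'I_N + 'I_m * 'X_{1..m < N}) : K :=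
  match t with inl k => psi`_k | inr (i, u) => - (q i)@_u end.
have lt0 : ((size psi).-1 < N)%N.
  by rewrite /N prednK ?leq_addr // size_poly_gt0.
have [||w [wt0 wr]] := @mpoly_relation_descent K m _ r v (inl (Ordinal lt0)).
- rewrite big_sumType /=.
  have -> : \sum_(i < N) psi`_i *: map_mpoly intr ('X_j ^+ i) = poly_at 'X_j psi.
    rewrite (@poly_at_sum _ _ _ _ N (leq_addr _ _)); apply: eq_bigr => k _.
    by rewrite rmorphXn /= map_mpolyX.
  rewrite e sum_pair /=.
  rewrite -big_split big1 //= => i _; rewrite (mpoly_mul_sum _ (sq i)) -big_split big1 //= => u _.
  by rewrite rmorphM /= map_mpolyX scaleNr subrr.
- by rewrite /= -lead_coefE lead_coef_eq0.
pose psi' := \poly_(k < N) (if insub k is Some k' then w (inl k') else 0).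
exists psi', (fun i => - \sum_u w (inr (i, u)) *: 'X_[(u : 'X_{1..m < N})]); split.
  apply: contra_neq wt0 => psi'0; have := congr1 (fun p : {poly int} => p`_(size psi).-1) psi'0.
  by rewrite coef_poly coef0 lt0 insubT.
rewrite (@poly_at_sum _ _ _ _ N) ?size_poly //; apply/eqP; rewrite -subr_eq0; apply/eqP.
rewrite -[RHS]wr big_sumType /=; congr (_ + _).
  by apply: eq_bigr => k _; rewrite coef_poly ltn_ord valK.
rewrite sum_pair /=.
rewrite -sumrN; apply: eq_bigr => i _; rewrite mulNr opprK big_distrl /=.
by apply: eq_bigr => u _; rewrite scalerAl.
Qed.

Lemma finite_zeros_coordinate (K : numClosedFieldType) m (G : 'I_m -> {mpoly int[m]}) j
  (s : seq K) :
  (forall w, (forall i, (map_mpoly intr (G i)).@[w] = 0) -> w j \in s) ->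
  exists (psi : {poly int}) (q : 'I_m -> {mpoly int[m]}),
    psi != 0 /\ poly_at 'X_j psi = \sum_i q i * G i.
Proof.
move=> fin; pose psi := \prod_(a <- s) ('X - a%:P).
have psi0 : psi != 0 by apply: monic_neq0; apply: monic_prod_XsubC.
pose f : {mpoly K[m]} := poly_at 'X_j psi.
have fE w : f.@[w] = psi.[w j].
  rewrite /f (poly_at_sum _ (leqnn _)) raddf_sum horner_coef /=.
  by apply: eq_bigr => k _; rewrite mevalZ rmorphXn /= mevalXU.
have f0 : f != 0.
  apply: contra_neq psi0 => f0; apply/polyP => k; rewrite coef0.
  have [lt_k|le_k] := ltnP k (size psi); last by rewrite nth_default.
  have := congr1 (mcoeff (U_(j) *+ k)%MM) f0; rewrite mcoeff0 /f (poly_at_sum _ (leqnn _)) raddf_sum /=.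
  rewrite (bigD1 (Ordinal lt_k)) //= mcoeffZ mcoeffXn eqxx mulr1 big1 ?addr0 // => i ne_ik.
  rewrite mcoeffZ mcoeffXn; case: eqP => [/mnmP/(_ j)|]; rewrite ?mulr0 //.
  by rewrite !mulmnE mnm1E eqxx !mul1n => ik; case/eqP: ne_ik; apply: val_inj.
have natK : injective (fun k : nat => k%:R : K) by move=> a b /eqP; rewrite eqr_nat => /eqP.
have [|N [q fN]] := nullstellensatz natK (G := fun i => map_mpoly intr (G i)) f0.
  by move=> w wz; rewrite fE; apply/rootP; rewrite root_prod_XsubC; apply: fin.
apply: (membership_descent (psi := psi ^+ N) (q := q)); first exact: expf_neq0.
by rewrite -fN /f /poly_at rmorphXn /= horner_exp.
Qed.

(** * Factorial rings *)

Definition divides (A : comNzRingType) (a b : A) := exists c, b = a * c.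

Definition prime_elt (A : idomainType) (p : A) :=
  [/\ p != 0, p \isn't a GRing.unit &
      forall a b, divides p (a * b) -> divides p a \/ divides p b].

(** Asking for prime rather than irreducible factors makes uniqueness automatic. *)
Definition factorial_ring (A : idomainType) := forall a : A, a != 0 ->
  exists u s, [/\ u \is a GRing.unit, (forall x, x \in s -> prime_elt x) &
                  a = u * \prod_(x <- s) x].

Section PrimeElt.
Variable A : idomainType.
Implicit Types (p x a b : A) (s : seq A).

Lemma prime_elt_unitl p x w : prime_elt p -> prime_elt x -> x = p * w ->
  w \is a GRing.unit.
Proof.
move=> [p0 pU _] [x0 xU px] xE.
have [|[t pE]|[t wE]] := px p w; first by exists 1; rewrite mulr1.
- apply/unitrP; exists t; suff e : t * w = 1 by split; rewrite // mulrC.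
  by apply: (mulfI x0); rewrite mulrA -pE -xE mulr1.
- case/negP: pU; apply/unitrP; exists t; suff e : t * p = 1 by split; rewrite // mulrC.
  by apply: (mulfI x0); rewrite mulr1 mulrA -wE mulrC -xE.
Qed.

(** Cancelling a prime shortens the factor list; this length is the induction measure in
    [primitive_part]. *)
Lemma prime_dvd_prod p s : prime_elt p -> (forall x, x \in s -> prime_elt x) ->
  forall u l, u \is a GRing.unit -> p * l = u * \prod_(x <- s) x ->
  exists u' s', [/\ u' \is a GRing.unit, (size s' < size s)%N,
    forall x, x \in s' -> prime_elt x & l = u' * \prod_(x <- s') x].
Proof.
move=> pp; elim: s => [|x s IHs] ps u l uU.
  case: (pp) => _ /negP pU _; rewrite big_nil mulr1 => e; case: pU.
  apply/unitrP; exists (l / u); suff e' : l / u * p = 1 by split; rewrite // mulrC.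
  by rewrite mulrAC [l * p]mulrC e divrr.
rewrite big_cons mulrCA => e.
have px : prime_elt x by apply: ps; rewrite inE eqxx.
have ps' y : y \in s -> prime_elt y by move=> ys; apply: ps; rewrite inE ys orbT.
case: (pp) => p0 _ /(_ x (u * \prod_(x <- s) x)) [|[w xE]|[t tE]]; first by exists l.
- exists (w * u), s; split=> //; first by rewrite unitrMl // (prime_elt_unitl pp px xE).
  by apply: (mulfI p0); rewrite e xE !mulrA.
- have [u' [s' [u'U szs' ps'' tE']]] := IHs ps' u t uU (esym tE).
  exists u', (x :: s'); split=> //.
    by move=> y; rewrite inE => /orP [/eqP -> //|]; apply: ps''.
  by apply: (mulfI p0); rewrite e tE big_cons mulrCA tE' mulrA [u' * (x * _)]mulrCA !mulrA.
Qed.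

End PrimeElt.

Section FactorialPoly.
Variable A : idomainType.
Hypothesis factA : factorial_ring A.
Implicit Types (p a b c : A) (f g h q : {poly A}).

(** Gauss's lemma without the quotient by [p]. If [p] divides the constant coefficient of the first
    factor, that coefficient is dropped and 'X cancelled. Otherwise [p] divides the constant
    coefficient of the second factor, and the same is done there. *)
Lemma prime_polyC p : prime_elt p -> prime_elt p%:P.
Proof.
move=> [p0 pU pp]; split; first by rewrite polyC_eq0.
  by apply: contra pU; rewrite poly_unitE coefC eqxx => /andP [].
have dvdX f : divides p%:P (f * 'X) -> divides p%:P f.
  move=> [q qE]; exists (\poly_(i < size q) q`_i.+1); apply/polyP => i.
  have := congr1 (fun g => g`_i.+1) qE; rewrite coefMX coefCM /= => ->.
  rewrite coefCM coef_poly; case: ltnP => // le_qi.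
  by rewrite nth_default // ltnW.
have dvdD f g : divides p%:P f -> divides p%:P g -> divides p%:P (f + g).
  by move=> [a ->] [b ->]; exists (a + b); rewrite mulrDr.
have dvdMl f g : divides p%:P f -> divides p%:P (g * f).
  by move=> [a ->]; exists (g * a); rewrite mulrCA.
have dvdC a : divides p a -> divides p%:P a%:P.
  by move=> [b ->]; exists b%:P; rewrite polyCM.
have dvdN f : divides p%:P f -> divides p%:P (- f).
  by move=> [a ->]; exists (- a); rewrite mulrN.
have dvdc f : divides p%:P f -> divides p f`_0.
  by move=> [a ->]; exists a`_0; rewrite coefCM.
have c0 f b : (f * 'X + b%:P)`_0 = b by rewrite coefD coefMX coefC add0r.
elim/poly_ind=> [|f a IHf] g; first by left; exists 0; rewrite mulr0.
have [pa|npa] := lem (divides p a).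
  move=> dv; have /IHf [pf|pg] : divides p%:P (f * g); last by right.
    apply: (dvdX); rewrite mulrAC.
    rewrite -[f * 'X](addrK a%:P) mulrBl; apply: (dvdD _ _ dv); apply: (dvdN).
    by rewrite mulrC; apply: (dvdMl); apply: (dvdC).
  by left; apply: (dvdD); [rewrite mulrC; apply: (dvdMl) | apply: (dvdC)].
move=> dv; right; elim/poly_ind: g dv => [|g b IHg] dv; first by exists 0; rewrite mulr0.
have pb : divides p b.
  have := dvdc _ dv; rewrite coefM big_ord_recl big_ord0 addr0 subn0 !c0.
  by case/pp.
apply: (dvdD); last exact: dvdC.
rewrite mulrC; apply: (dvdMl); apply: IHg; apply: (dvdX); rewrite -mulrA.
rewrite -[g * 'X](addrK b%:P) mulrBr; apply: (dvdD _ _ dv); apply: (dvdN).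
by apply: (dvdMl); apply: (dvdC).
Qed.

Definition primitive_poly f := forall p, prime_elt p -> ~ divides p%:P f.

(** Turns divisibility up to constants, which is all that [%|] gives over a domain, into
    divisibility. Each prime factor of [c] divides f q but not [f], so it can be cancelled from
    [q]. *)
Lemma primitive_cancel f q c g : primitive_poly f -> c != 0 ->
  c%:P * g = f * q -> divides f g.
Proof.
move=> primf /factA [u [s [uU ps ->]]]; elim: s q ps => [|p s IHs] q ps.
  rewrite big_nil mulr1 => e; exists (q * (u^-1)%:P).
  by rewrite mulrA -e mulrAC -polyCM divrr // mul1r.
rewrite big_cons mulrCA polyCM -mulrA => e.
have pp : prime_elt p by apply: ps; rewrite inE eqxx.
have [p0 pU pdv] := prime_polyC pp.
have [|/(primf _ pp) //|[q1 qE]] := pdv f q; first by exists ((u * \prod_(x <- s) x)%:P * g).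
apply: (IHs q1) => [x xs|]; first by apply: ps; rewrite inE xs orbT.
by apply: (mulfI p0); rewrite e qE mulrCA.
Qed.

(** Every prime pulled out of [f] also leaves the factorisation of the leading coefficient, so the
    process ends. *)
Lemma primitive_part f : f != 0 ->
  exists c f1, [/\ c != 0, primitive_poly f1 & f = c%:P * f1].
Proof.
move=> f0; have lf0 : lead_coef f != 0 by rewrite lead_coef_eq0.
have [u [s [uU ps]]] := factA lf0.
have [n] := ubnP (size s); elim: n => // n IHn in f f0 lf0 u s uU ps * => szs lfE.
have [primf|/existsNP [p]] := lem (primitive_poly f).
  by exists 1, f; split=> //; rewrite ?oner_eq0 ?mul1r.
move=> /not_implyP [pp /contrapT [g gE]].
have g0 : g != 0 by apply: contraNneq f0 => g0; rewrite gE g0 mulr0.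
have lg0 : lead_coef g != 0 by rewrite lead_coef_eq0.
have lE : p * lead_coef g = u * \prod_(x <- s) x by rewrite -lfE gE lead_coefM lead_coefC.
have [u' [s' [u'U szs' ps' lgE]]] := prime_dvd_prod pp ps uU lE.
have [c [f1 [c0 pf1 gE']]] := IHn g g0 lg0 u' s' u'U ps' (leq_trans szs' szs) lgE.
exists (p * c), f1; split=> //; last by rewrite gE gE' polyCM mulrA.
by rewrite mulf_neq0 //; case: pp.
Qed.

Import Pdiv.Idomain.

Lemma common_factor f g : f != 0 ->
  exists e, [/\ divides e f, divides e g &
    exists c u v, c != 0 /\ c%:P * e = u * f + v * g].
Proof.
move=> f0; have d0 : gcdp f g != 0 by rewrite gcdp_eq0 (negbTE f0).
have [c [e [c0 pe dE]]] := primitive_part d0; exists e; split.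
- have [[a q] /= a0 aE] := dvdpP _ _ (dvdp_gcdl f g).
  by apply: (@primitive_cancel e (q * c%:P) a) => //; rewrite mul_polyC aE dE mulrA mulrC.
- have [[a q] /= a0 aE] := dvdpP _ _ (dvdp_gcdr f g).
  by apply: (@primitive_cancel e (q * c%:P) a) => //; rewrite mul_polyC aE dE mulrA mulrC.
have [[u v] /= /eqpP [[a b] /= /andP [a0 b0] e1]] := Bezoutp f g.
exists (b * c), (a *: u), (a *: v); split; first by rewrite mulf_neq0.
by rewrite -!scalerAl -scalerDr e1 dE polyCM -mulrA mul_polyC.
Qed.

Lemma factorial_poly : factorial_ring {poly A}.
Proof.
move=> f; have [n] := ubnP (size f); elim: n f => // n IHn f szf f0.
have [c [f1 [c0 pf1 fE]]] := primitive_part f0.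
have f10 : f1 != 0 by apply: contraNneq f0 => e; rewrite fE e mulr0.
suff [u [s [uU ps f1E]]] : exists u s, [/\ u \is a GRing.unit,
    (forall x, x \in s -> prime_elt x) & f1 = u * \prod_(x <- s) x].
  have [v [t [vU pt cE]]] := factA c0.
  exists (v%:P * u), ([seq x%:P | x <- t] ++ s); split.
  - by rewrite unitrMl //; apply: (rmorph_unit (@polyC A) vU).
  - move=> x; rewrite mem_cat => /orP [/mapP [y yt ->]|]; last exact: ps.
    by apply: prime_polyC; apply: pt.
  - by rewrite fE f1E cE big_cat big_map /= polyCM rmorph_prod -!mulrA; congr (_ * _); rewrite mulrCA.
have szf1 : (size f1 < n.+1)%N by move: szf; rewrite fE mul_polyC size_scale.
have [sz1|sz1] := leqP (size f1) 1.
  have f1E := size1_polyC sz1; set a := f1`_0 in f1E.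
  have a0 : a != 0 by rewrite -polyC_eq0 -f1E.
  have [v [[|p t] [vU pt aE]]] := factA a0.
    exists f1, [::]; split=> //; last by rewrite big_nil mulr1.
    move: aE; rewrite big_nil mulr1 => aE.
    by rewrite poly_unitE -/a {1}f1E size_polyC a0 aE.
  case: (pf1 p); first by apply: pt; rewrite inE eqxx.
  rewrite f1E aE big_cons mulrCA polyCM; by eexists.
have [[g [h [f1E sg sh]]]|irr] :=
    lem (exists g h, [/\ f1 = g * h, (1 < size g)%N & (1 < size h)%N]).
  have [g0 h0] : g != 0 /\ h != 0 by split; rewrite -size_poly_gt0 ltnW.
  have szgh : (size f1).+1 = (size g + size h)%N.
    by rewrite f1E size_mul // prednK // addn_gt0 size_poly_gt0 g0.
  have [|u [s [uU ps gE]]] := IHn g _ g0.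
    by move: szgh szf1 sh; clear; lia.
  have [|v [t [vU pt hE]]] := IHn h _ h0.
    by move: szgh szf1 sg; clear; lia.
  exists (u * v), (s ++ t); split; first by rewrite unitrMl.
    by move=> x; rewrite mem_cat => /orP []; [apply: ps | apply: pt].
  by rewrite f1E gE hE big_cat /= mulrACA.
exists 1, [:: f1]; split; rewrite ?unitr1 //; last by rewrite big_seq1 mul1r.
move=> x; rewrite inE => /eqP -> {x}; split=> //.
  by apply: contraTN sz1; rewrite poly_unitE => /andP [/eqP -> _].
move=> g h [q ghE].
(* Here [f1] is primitive and has no two nonconstant factors. If it is coprime to [g] over the
   fractions, it divides [h]; otherwise the primitive part of the gcd is nonconstant, so it equals
   [f1] up to a constant, and [f1] divides [g]. *)
have dv : f1 %| g * h by apply/dvdpP; exists (1, q); rewrite /= ?oner_eq0 // scale1r ghE mulrC.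
have [cop|ncop] := boolP (coprimep f1 g).
  right; have : f1 %| h by rewrite -(Gauss_dvdpr _ cop).
  by case/dvdpP => -[a r] /= a0 aE; apply: (primitive_cancel (q := r) pf1 a0); rewrite mul_polyC aE mulrC.
left; have d0 : gcdp f1 g != 0 by rewrite gcdp_eq0 (negbTE f10).
have [b [e [b0 pe dE]]] := primitive_part d0.
have se : (1 < size e)%N.
  move: ncop; rewrite coprimep_def dE mul_polyC size_scale // => ne1.
  rewrite ltn_neqAle eq_sym ne1 size_poly_gt0.
  by apply: contraNneq d0 => e0; rewrite dE e0 mulr0.
have [[a r] /= a0 aE] := dvdpP _ _ (dvdp_gcdl f1 g).
have [w f1E] : divides e f1.
  by apply: (@primitive_cancel e (r * b%:P) a) => //; rewrite mul_polyC aE dE mulrA mulrC.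
have sw : (size w <= 1)%N.
  by rewrite leqNgt; apply/negP => sw; case: irr; exists e, w.
have [[a' r'] /= a'0 a'E] := dvdpP _ _ (dvdp_gcdr f1 g).
have := size1_polyC sw; set w0 := w`_0 => wE.
have w0_neq0 : w0 != 0.
  by apply: contraNneq f10 => w00; rewrite f1E wE w00 mulr0.
apply: (@primitive_cancel f1 (r' * b%:P) (a' * w0)) => //; first by rewrite mulf_neq0.
by rewrite f1E wE polyCM mulrAC mul_polyC a'E dE; ring.
Qed.

End FactorialPoly.

Lemma factorial_iso (A B : idomainType) (f : {rmorphism A -> B}) (g : {rmorphism B -> A}) :
  cancel f g -> cancel g f -> factorial_ring A -> factorial_ring B.
Proof.
move=> fK gK factA b b0.
have gb0 : g b != 0 by rewrite raddf_eq0 //; apply: can_inj gK.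
have [u [s [uU ps gbE]]] := factA _ gb0.
exists (f u), (map f s); split; first exact: rmorph_unit.
  move=> x /mapP [y ys ->] {x}; have [y0 yU pry] := ps y ys; split.
  - by rewrite raddf_eq0 //; apply: can_inj fK.
  - by apply: contra yU => /(rmorph_unit g); rewrite fK.
  - move=> c d [q qE]; have : divides y (g c * g d).
      by exists (g q); rewrite -rmorphM qE rmorphM fK.
    by case/pry => -[t tE]; [left|right]; exists (f t); rewrite -rmorphM -tE gK.
by rewrite -[b]gK gbE rmorphM rmorph_prod big_map.
Qed.

Lemma factorial_mpoly (A : idomainType) n : factorial_ring A -> factorial_ring {mpoly A[n]}.
Proof.
move=> factA; elim: n => [|n IHn].
  apply: (@factorial_iso A {mpoly A[0]} (@mpolyC 0 A) (mcoeff 0%MM)) => //.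
    exact: mpolyCK.
  exact: mpolyKC.
have factP : factorial_ring {poly {mpoly A[n]}} by apply: factorial_poly.
exact: (@factorial_iso {poly {mpoly A[n]}} {mpoly A[n.+1]} (@munhead n A) (@mhead n A)
  (@munheadK n A) (@mheadK n A) factP).
Qed.

Lemma factorial_int : factorial_ring int.
Proof.
have prime_int p : prime p -> prime_elt (p%:Z).
  move=> pp; split; first by rewrite eqz_nat -lt0n prime_gt0.
    by apply/negP; case: p pp => [|[|p]].
  move=> a b [c /(congr1 absz)]; rewrite !abszM => e.
  have : (p %| `|a| * `|b|)%N by rewrite e dvdn_mulr.
  rewrite Euclid_dvdM // => /orP [d|d].
    by left; have /dvdzP [q ->] : (p%:Z %| a)%Z by []; exists q; rewrite mulrC.
  by right; have /dvdzP [q ->] : (p%:Z %| b)%Z by []; exists q; rewrite mulrC.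
move=> a a0.
have [s [ps nE]] : exists s, (forall p, p \in s -> prime p) /\ `|a|%N = (\prod_(p <- s) p)%N.
  have na0 : (0 < `|a|)%N by rewrite absz_gt0.
  have [n] := ubnP `|a|%N; move: `|a|%N na0 => k; elim: n k => // n IHn k k0 kn.
  have [k1|k1] := leqP k 1; first by exists [::]; rewrite big_nil; split=> //; apply/eqP; rewrite eqn_leq k1.
  have pk := pdiv_prime k1; have [||s [ps kE]] := IHn (k %/ pdiv k)%N.
  - by rewrite divn_gt0 ?prime_gt0 // dvdn_leq // pdiv_dvd.
  - by rewrite -ltnS; apply: leq_trans kn; rewrite ltnS ltn_Pdiv ?prime_gt1.
  exists (pdiv k :: s); split; first by move=> p; rewrite inE => /orP [/eqP -> //|/ps].
  by rewrite big_cons -kE mulnC divnK ?pdiv_dvd.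
exists (sgz a), [seq p%:Z | p <- s]; split.
- by case: (sgzP a) a0 => // ->; rewrite eqxx.
- by move=> x /mapP [p /ps pp ->]; apply: prime_int.
- rewrite big_map {1}[a]intEsg nE; congr (_ * _).
  by rewrite (big_morph Posz PoszM (erefl _)).
Qed.

(** * Integrality of z s(T) *)

Local Open Scope quotient_scope.

Section IdealQuotient.
Variables (B : comNzRingType) (I : B -> Prop).
Hypotheses (I_ideal : is_ideal I) (I1 : ~ I 1).

Definition ideal_pred : {pred B} := fun b => `[<I b>].

Fact ideal_pred_closed : idealr_closed ideal_pred.
Proof.
have [I0 ID IM] := I_ideal; split; rewrite ?unfold_in.
- exact/asboolP.
- exact/asboolP.
- move=> a x y /asboolP Ix /asboolP Iy; apply/asboolP.
  by apply: ID => //; apply: IM.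
Qed.

HB.instance Definition _ := isIdealr.Build B ideal_pred ideal_pred_closed.

Lemma quotient_by_ideal :
  exists (Q : comNzRingType) (pi : {rmorphism B -> Q}), forall b, pi b = 0 <-> I b.
Proof.
exists {ideal_quot ideal_pred}, (\pi_{ideal_quot ideal_pred}) => b.
rewrite -(rmorph0 (\pi_{ideal_quot ideal_pred})).
split=> [/eqP|Ib]; last apply/eqP; rewrite -Quotient.idealrBE subr0 unfold_in.
  by move/asboolP.
exact/asboolP.
Qed.

End IdealQuotient.

(** With a = lead_coef p and n the degree, a^(n-1) p(x) = 0 is a monic equation for a x. *)
Lemma integral_scale (R K : comNzRingType) (h : {rmorphism R -> K}) (p : {poly R}) x :
  (map_poly h p).[x] = 0 -> integralOver h (h (lead_coef p) * x).
Proof.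
move=> px; set a := lead_coef p; pose n := (size p).-1.
(* A constant [p] with a root maps to 0, so the scaled element is 0. *)
have [sp|sp] := leqP (size p) 1.
  have [c pE] : exists c, p = c%:P by exists p`_0; apply: size1_polyC.
  rewrite /a; move: px; rewrite pE lead_coefC map_polyC hornerC /= => ->; rewrite mul0r; exact: integral0.
have szp : size p = n.+1 by rewrite /n prednK // ltnW.
pose r := \poly_(i < n) (p`_i * a ^+ (n.-1 - i)); pose q := 'X^n + r.
have szl : (size r < size ('X^n : {poly R}))%N.
  by rewrite size_polyXn ltnS size_poly.
exists q; first by rewrite monicE /q lead_coefDl // lead_coefXn.
have n0 : (0 < n)%N by rewrite -ltnS -szp.
apply/rootP; rewrite /q rmorphD /= map_polyXn hornerD hornerXn.
have -> : (map_poly h r).[h a * x] =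
    h a ^+ n.-1 * \sum_(i < n) h p`_i * x ^+ i.
  rewrite (@horner_coef_wide _ n); last by rewrite (leq_trans (size_poly _ _)) ?size_poly.
  rewrite big_distrr; apply: eq_bigr => i _ /=.
  rewrite coef_map coef_poly ltn_ord /= rmorphM rmorphXn exprMn.
  have le_i : (i <= n.-1)%N by rewrite -ltnS prednK.
  rewrite -[in RHS](subnK le_i) exprD; set u := h a ^+ _; set v := h a ^+ _.
  by ring.
have := px; rewrite (@horner_coef_wide _ n.+1); last by rewrite -szp size_poly.
rewrite big_ord_recr /=; under eq_bigr do rewrite coef_map /=.
rewrite coef_map /= [p`_n](_ : _ = a); last by rewrite /a lead_coefE.
move/(congr1 ( *%R (h a ^+ n.-1))); rewrite mulr0 mulrDr => e.
rewrite -[RHS]e [LHS]addrC; congr (_ + _); rewrite exprMn mulrA; congr (_ * _).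
by rewrite -exprSr prednK.
Qed.

Section LocallyIntegral.
Variables (L : idomainType) (C K : comNzRingType).
Variables (k : {rmorphism L -> C}) (h : {rmorphism C -> K}).

(* Integrality over [C] after inverting the nonzero elements of [L]. *)
Definition loc_integral (w : K) := exists c, c != 0 /\ integralOver h (h (k c) * w).

Lemma loc_integralC c : loc_integral (h c).
Proof. by exists 1; rewrite oner_eq0 !rmorph1 mul1r; split=> //; apply: integral_id. Qed.

Lemma loc_integralM u v : loc_integral u -> loc_integral v -> loc_integral (u * v).
Proof.
move=> [c [c0 uI]] [d [d0 vI]]; exists (c * d); rewrite mulf_neq0 //; split=> //.
by rewrite !rmorphM mulrACA; apply: integral_mul.
Qed.

Lemma loc_integralD u v : loc_integral u -> loc_integral v -> loc_integral (u + v).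
Proof.
move=> [c [c0 uI]] [d [d0 vI]]; exists (c * d); rewrite mulf_neq0 //; split=> //.
rewrite !rmorphM mulrDr; apply: integral_add.
  by rewrite [h (k c) * _]mulrC -mulrA; apply: integral_mul => //; apply: integral_id.
by rewrite -mulrA; apply: integral_mul => //; apply: integral_id.
Qed.

Lemma loc_integralX u n : loc_integral u -> loc_integral (u ^+ n).
Proof.
move=> uI; elim: n => [|n IHn]; last by rewrite exprS; apply: loc_integralM.
by rewrite expr0 -(rmorph1 h); apply: loc_integralC.
Qed.

Lemma loc_integral_sum (J : Type) (r : seq J) (P : pred J) F :
  (forall j, P j -> loc_integral (F j)) -> loc_integral (\sum_(j <- r | P j) F j).
Proof.
move=> FI; apply: (big_ind loc_integral) => //; last exact: loc_integralD.
by rewrite -(rmorph0 h); apply: loc_integralC.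
Qed.

Lemma loc_integral_prod (J : Type) (r : seq J) (P : pred J) F :
  (forall j, P j -> loc_integral (F j)) -> loc_integral (\prod_(j <- r | P j) F j).
Proof.
move=> FI; apply: (big_ind loc_integral) => //; last exact: loc_integralM.
by rewrite -(rmorph1 h); apply: loc_integralC.
Qed.

Lemma loc_integralN u : loc_integral u -> loc_integral (- u).
Proof.
by move=> uI; rewrite -mulN1r; apply: loc_integralM => //; rewrite -(rmorphN1 h); apply: loc_integralC.
Qed.

Lemma loc_integral_mmap n (R : nzRingType) (f : R -> K) (x : 'I_n -> K) p :
  (forall c, loc_integral (f c)) -> (forall i, loc_integral (x i)) ->
  loc_integral (mmap f x p).
Proof.
move=> fI xI; apply: loc_integral_sum => m _; apply: loc_integralM => //.
by apply: loc_integral_prod => i _; apply: loc_integralX.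
Qed.

End LocallyIntegral.

(* Generic coefficients: the substitution [a_ij := a_ij + t_i] turns [Y_i] into
   [Y_i + t_i x], so for suitable [t] any algebraic relation between the [Y_i]
   and [x] becomes one whose leading coefficient in [x] is free of the [Y_i]. *)
Lemma shear_loc_integral (L : idomainType) (B : comNzRingType) n
  (iota : {rmorphism L -> B}) (Y : 'I_n -> B) (x : B) (f : {mpoly L[n.+1]}) :
  injective (fun j : nat => j%:R : L) ->
  (forall t : 'I_n -> nat, exists (s : {rmorphism L -> L}) (sB : {rmorphism B -> B}),
     [/\ injective s, forall c, sB (iota c) = iota (s c), sB x = x &
         forall i, sB (Y i) = Y i + x *+ t i]) ->
  f != 0 -> mmap iota (on_cons x Y) f = 0 ->
  loc_integral (@mpolyC n L) (mmap iota Y) x.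
Proof.
move=> natL shiftP f0 fz; have [t [c [c0 lf]]] := shear_monic natL f0.
have [s [sB [s_inj sBC sBx sBY]]] := shiftP t.
exists (s c); split; first by rewrite raddf_eq0.
pose p := map_poly (map_mpoly s) (shear t f).
have lp : lead_coef p = (s c)%:MP.
  rewrite /p lead_coef_map_eq lf /= ?map_mpolyC //.
  by rewrite mpolyC_eq0 raddf_eq0.
suff px : (map_poly (mmap iota Y) p).[x] = 0 by have := integral_scale px; rewrite lp.
rewrite /p.
(* Shearing [f] and then substituting is the same as substituting and then shifting the parameters,
   up to [s] on the coefficients; both sides are ring morphisms in [f]. *)
suff -> : (map_poly (mmap iota Y) (map_poly (map_mpoly s) (shear t f))).[x] =
    sB (mmap iota (on_cons x Y) f) by rewrite fz rmorph0.
apply: (mpoly_hom_ext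
  (f := horner_eval x \o map_poly (mmap iota Y) \o map_poly (map_mpoly s) \o shear t)
  (g := sB \o mmap iota (on_cons x Y))) => [d|i] /=.
  by rewrite shearC !map_polyC /= map_mpolyC !mmapC /horner_eval hornerC sBC.
rewrite mmapXU; case: (unliftP ord0 i) => [j|] ->.
  rewrite shearS on_consS !rmorphD !rmorphMn /= !map_polyC !map_polyX /=.
  by rewrite map_mpolyX mmapXU /horner_eval hornerC hornerX sBY.
by rewrite shear0 !map_polyX /horner_eval hornerX on_cons0 sBx.
Qed.

Definition int_eval n (A : comNzRingType) (x : 'I_n -> A) : {mpoly int[n]} -> A :=
  mmap (intmul 1) x.
HB.instance Definition _ n A x := GRing.RMorphism.on (@int_eval n A x).

Lemma int_eval_hom n (A A' : comNzRingType) (f : {rmorphism A -> A'}) x p :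
  f (@int_eval n A x p) = int_eval (f \o x) p.
Proof.
apply: (mpoly_hom_ext (f := f \o int_eval x) (g := int_eval (f \o x))) => [c|i] /=.
  by rewrite /int_eval !mmapC rmorph_int.
by rewrite /int_eval !mmapXU.
Qed.

Lemma int_eval_comb n (A : comNzRingType) (x : 'I_n -> A) (I : finType)
    (g h : I -> {mpoly int[n]}) :
  int_eval x (\sum_i g i * h i) = \sum_i int_eval x (g i) * int_eval x (h i).
Proof.
transitivity (\sum_i int_eval x (g i * h i)); first exact: (raddf_sum (int_eval x)).
by apply: eq_bigr => i _; apply: rmorphM.
Qed.

Lemma int_eval_ext n (A : comNzRingType) (x y : 'I_n -> A) : x =1 y -> int_eval x =1 int_eval y.
Proof.
by move=> e p; rewrite /int_eval /mmap; apply: eq_bigr => u _; rewrite (mmap1_eq u e).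
Qed.

(* The universal property of [L = Z[a_ij]]: the [a_ij] generate [L] and are
   algebraically independent over [Z]. *)
Record free_params (L : idomainType) m n (a : 'I_m -> 'I_n -> L) : Prop := FreeParams {
  free_lift : forall (A : comNzRingType) (b : 'I_m -> 'I_n -> A),
    exists h : {rmorphism L -> A}, forall i j, h (a i j) = b i j;
  free_ext : forall (A : comNzRingType) (h h' : {rmorphism L -> A}),
    (forall i j, h (a i j) = h' (a i j)) -> h =1 h' }.

Lemma free_params_nat (L : idomainType) m n (a : 'I_m -> 'I_n -> L) :
  free_params a -> injective (fun k : nat => k%:R : L).
Proof.
move=> [lift _] k l kl; have [h _] := lift int (fun _ _ => 0).
by have := congr1 h kl; rewrite !rmorph_nat => /eqP; rewrite eqr_nat => /eqP.
Qed.

Section Deformation.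
Variables (q D : nat).
Local Notation m := q.+1.
Variable G : 'I_m -> {mpoly int[m]}.

(* Index [ord_max] is the linear form [T]; index [lift ord_max k] is [Y_k]. *)
Definition deform (A : comNzRingType) (b : 'I_m.+1 -> 'I_m -> A) (x : 'I_m -> A) (z : A)
    (i : 'I_m.+1) : A :=
  (if unlift ord_max i is Some k then z * int_eval x (G k) + x k ^+ D else x ord0)
    + \sum_j b i j * x j.

Lemma deform_hom (A A' : comNzRingType) (f : {rmorphism A -> A'}) b x z i :
  f (deform b x z i) = deform (fun i j => f (b i j)) (f \o x) (f z) i.
Proof.
rewrite /deform rmorphD rmorph_sum; congr (_ + _); last first.
  by apply: eq_bigr => j _; rewrite rmorphM.
by case: unlift => [k|] //; rewrite rmorphD rmorphM rmorphXn int_eval_hom.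
Qed.

Lemma deform_ext (A : comNzRingType) b b' (x x' : 'I_m -> A) z i :
  (forall i j, b i j = b' i j) -> x =1 x' -> deform b x z i = deform b' x' z i.
Proof.
move=> eb ex; rewrite /deform; congr (_ + _); last first.
  by apply: eq_bigr => j _; rewrite eb ex.
by case: unlift => [k|] //; rewrite ?(int_eval_ext ex) ex.
Qed.

Section Generic.
Variables (L : idomainType) (a : 'I_m.+1 -> 'I_m -> L).
Hypothesis aP : free_params a.

Local Notation B := {mpoly L[m.+1]}.
Definition genx (j : 'I_m) : B := 'X_(lift ord0 j).
Definition genz : B := 'X_ord0.
Definition genY (i : 'I_m.+1) : B := deform (fun i j => (a i j)%:MP) genx genz i.
Definition subY : B -> B := mmap (@mpolyC m.+1 L) genY.
HB.instance Definition _ := GRing.RMorphism.on subY.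

(** x_j, the Y_i and T are m + 2 elements of a polynomial ring in m + 1 variables, hence
    algebraically dependent. Shifting only the j-th column of parameters adds t_i x_j to each form;
    the opposite shift is its inverse. *)
Lemma genx_loc_integral j : loc_integral (@mpolyC m.+1 L) subY (genx j).
Proof.
have natL := free_params_nat aP.
have [f [f0 fz]] := algebraic_relation (on_cons (genx j) genY).
apply: shear_loc_integral natL _ f0 fz => t.
have [s sE] := free_lift aP (fun i k => a i k + (k == j)%:R *+ t i).
have [s' s'E] := free_lift aP (fun i k => a i k - (k == j)%:R *+ t i).
exists s, (map_mpoly s); split.
- apply: (can_inj (g := s')); apply: (free_ext aP (h := s' \o s) (h' := idfun)) => i k /=.
  by rewrite sE rmorphD rmorphMn rmorph_nat s'E subrK.
- by move=> c; rewrite /= map_mpolyC.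
- by rewrite /genx /= map_mpolyX.
- move=> i; rewrite /genY deform_hom /=.
  rewrite (@deform_ext _ _ (fun i k => (a i k)%:MP + (k == j)%:R *+ t i) _ genx); first last.
  + by move=> k /=; rewrite /genx map_mpolyX.
  + by move=> i' k; rewrite /= map_mpolyC /= sE rmorphD rmorphMn rmorph_nat.
  rewrite /genz /= map_mpolyX /deform -addrA; congr (_ + _).
  under eq_bigr do rewrite mulrDl; rewrite big_split /=; congr (_ + _).
  rewrite (bigD1 j) //= eqxx mulrnAl mul1r big1 ?addr0 // => k /negbTE ->.
  by rewrite mul0rn mul0r.
Qed.

Lemma subYC c : subY c%:MP = c%:MP.
Proof. by rewrite /subY mmapC. Qed.

Lemma subYX i : subY 'X_i = genY i.
Proof. by rewrite /subY mmapXU. Qed.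

Lemma genzG_loc_integral k :
  loc_integral (@mpolyC m.+1 L) subY (genz * int_eval genx (G k)).
Proof.
have -> : genz * int_eval genx (G k) = subY 'X_(lift ord_max k) -
    (genx k ^+ D + \sum_j subY (a (lift ord_max k) j)%:MP * genx j).
  rewrite subYX /genY /deform liftK.
  rewrite [X in _ = _ - (_ + X)](eq_bigr (fun j => (a (lift ord_max k) j)%:MP * genx j)).
    by rewrite -[X in X - _]addrA addrK.
  by move=> j _; rewrite subYC.
apply: loc_integralD; first exact: loc_integralC.
apply: loc_integralN; apply: loc_integralD.
  by apply: loc_integralX; apply: genx_loc_integral.
apply: loc_integral_sum => j _; apply: loc_integralM; first exact: loc_integralC.
exact: genx_loc_integral.
Qed.

Hypothesis coordP : forall j, exists (psi : {poly int}) (g : 'I_m -> {mpoly int[m]}),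
    psi != 0 /\ poly_at 'X_j psi = \sum_i g i * G i.

Lemma int_eval_poly_at (A : comNzRingType) (x : 'I_m -> A) j psi :
  int_eval x (poly_at 'X_j psi) = (map_poly (intmul 1) psi).[x j].
Proof.
apply: (poly_hom_ext (f := int_eval x \o horner_eval 'X_j \o map_poly (@mpolyC m int))
  (g := horner_eval (x j) \o map_poly (intmul 1))) => [c|] /=.
  by rewrite !map_polyC /horner_eval !hornerC /int_eval mmapC.
by rewrite !map_polyX /horner_eval !hornerX /int_eval mmapXU.
Qed.

Lemma genx_quotient_integral (Q : comNzRingType) (pi : {rmorphism B -> Q}) j :
  (forall i, pi (int_eval genx (G i)) = 0) ->
  loc_integral (idfun : {rmorphism L -> L}) (pi \o @mpolyC m.+1 L) (pi (genx j)).
Proof.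
move=> piG; have [psi [g [psi0 psiE]]] := coordP j.
have natL := free_params_nat aP.
have int0 (n : int) : (n%:~R == 0 :> L) = (n == 0).
  have nat0 (k : nat) : (k%:R == 0 :> L) = (k == 0)%N by rewrite -(inj_eq natL).
  case: n => k; first by rewrite -[Posz k]/(k%:Z) nat0.
  by rewrite NegzE rmorphN oppr_eq0 nat0.
pose p : {poly L} := map_poly (intmul 1) psi.
have lp : lead_coef p = (lead_coef psi)%:~R.
  by rewrite /p lead_coef_map_eq // int0 lead_coef_eq0.
exists (lead_coef p); split; first by rewrite lp int0 lead_coef_eq0.
apply: integral_scale; rewrite /p.
have -> : (map_poly (pi \o @mpolyC m.+1 L) (map_poly (intmul 1) psi)).[pi (genx j)] =
    pi (int_eval genx (poly_at 'X_j psi)).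
  rewrite int_eval_poly_at -horner_map -!map_poly_comp; congr (_.[_]).
  by apply: eq_map_poly => c /=; rewrite !rmorph_int.
rewrite psiE int_eval_comb rmorph_sum big1 // => i _ /=.
by rewrite rmorphM piG mulr0.
Qed.

(** Modulo (G) every x_j is a root of its integer polynomial from [coordP], so T is integral over L
    after inverting a constant. A polynomial that kills T in the quotient takes at T a value in
    (G). *)
Lemma genT_algebraic : exists (s : {poly L}) (g : 'I_m -> B),
  s != 0 /\ (map_poly (@mpolyC m.+1 L) s).[genY ord_max] = \sum_i g i * int_eval genx (G i).
Proof.
pose I b := exists g r, b = \sum_i g i * int_eval genx (G i) + r * 0.
have I_ideal : is_ideal I by apply: (combination_ideal (idfun : {rmorphism B -> B})).
have IE b : I b -> exists g : 'I_m -> B, b = \sum_i g i * int_eval genx (G i).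
  by move=> [g [r ->]]; exists g; rewrite mulr0 addr0.
have [/IE [g gE]|I1] := lem (I 1).
  exists 1, g; rewrite oner_neq0; split=> //.
  by rewrite rmorph1 hornerC.
have [Q [pi piE]] := quotient_by_ideal I_ideal I1.
have xint j : loc_integral (idfun : {rmorphism L -> L}) (pi \o @mpolyC m.+1 L) (pi (genx j)).
  by apply: genx_quotient_integral => i; apply/piE; apply: combination_gen.
have [c [c0 [p p_monic /rootP pz]]] :
    loc_integral (idfun : {rmorphism L -> L}) (pi \o @mpolyC m.+1 L) (pi (genY ord_max)).
  rewrite /genY /deform unlift_none rmorphD rmorph_sum; apply: loc_integralD; first exact: xint.
  apply: loc_integral_sum => j _; rewrite rmorphM; apply: loc_integralM; last exact: xint.
  exact: (loc_integralC _ (pi \o @mpolyC m.+1 L)).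
(* The monic equation is one for c T; rewritten for T it has leading coefficient a power of [c]. *)
pose s := p \Po (c *: 'X).
have s0 : s != 0.
  rewrite -lead_coef_eq0 /s lead_coef_comp; last by rewrite size_scale // size_polyX.
  by rewrite (monicP p_monic) mul1r lead_coefZ lead_coefX mulr1 expf_neq0.
have [|g gE] := IE ((map_poly (@mpolyC m.+1 L) s).[genY ord_max]); last by exists s, g.
apply/piE; rewrite -[RHS]pz -horner_map -map_poly_comp /s map_comp_poly horner_comp.
congr (_.[_]).
by rewrite map_polyZ map_polyX hornerZ hornerX.
Qed.

(** If s(T) = sum g_i G_i, then z s(T) = sum g_i (z G_i), where z G_i = Y_i - x_i^D - sum a_ij x_j
    is integral. *)
Lemma genzT_integral : exists (t : B) c (s : {poly L}) (p : {poly B}),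
  [/\ c != 0, s != 0, t = c%:MP * (map_poly (@mpolyC m.+1 L) s).['X_ord_max],
      p \is monic & (map_poly subY p).[subY t * genz] = 0].
Proof.
have [s [g [s0 sE]]] := genT_algebraic.
(* The cofactors g_i may contain z, whose integrality is not known. Setting z := 0 in them is
   harmless because T and the G_i are free of z. *)
have [z0 [z0C z0x z0I]] : exists z0 : {rmorphism B -> B},
    [/\ forall c, z0 c%:MP = c%:MP, z0 \o genx =1 genx &
        forall b, loc_integral (@mpolyC m.+1 L) subY (z0 b)].
  exists (mmap (@mpolyC m.+1 L) (on_cons 0 genx)); split=> [c|j|b] /=.
  - by rewrite mmapC.
  - by rewrite mmapXU on_consS.
  - apply: loc_integral_mmap => [e|j].
      by rewrite -subYC; apply: loc_integralC.
    case: (unliftP ord0 j) => [k|] ->; first by rewrite on_consS; apply: genx_loc_integral.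
    by rewrite on_cons0 -(rmorph0 subY); apply: loc_integralC.
have z0T : z0 (genY ord_max) = genY ord_max.
  rewrite /genY /deform unlift_none rmorphD rmorph_sum; congr (_ + _); first exact: z0x.
  by apply: eq_bigr => j _; rewrite rmorphM z0C; congr (_ * _); exact: z0x.
have sE' : (map_poly (@mpolyC m.+1 L) s).[genY ord_max] =
    \sum_i z0 (g i) * int_eval genx (G i).
  have := congr1 z0 sE; rewrite -horner_map z0T -map_poly_comp.
  rewrite (eq_map_poly z0C) => ->; rewrite rmorph_sum; apply: eq_bigr => i _.
  by rewrite rmorphM int_eval_hom (int_eval_ext z0x).
have [c [c0 [p p_monic /rootP pz]]] : loc_integral (@mpolyC m.+1 L) subY
    ((map_poly (@mpolyC m.+1 L) s).[genY ord_max] * genz).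
  rewrite sE' big_distrl; apply: loc_integral_sum => i _ /=.
  rewrite -mulrA [_ * genz]mulrC; apply: loc_integralM; [exact: z0I | exact: genzG_loc_integral].
exists (c%:MP * (map_poly (@mpolyC m.+1 L) s).['X_ord_max]), c, s, p; split=> //.
rewrite -[RHS]pz rmorphM -mulrA; congr (_.[_ * (_ * _)]).
rewrite -horner_map -map_poly_comp /= subYX; congr (_.[_]).
by apply: eq_map_poly => e /=; rewrite subYC.
Qed.

End Generic.
End Deformation.

(** * Macaulay's determinant *)

(** [P n a] stands for degree at most n. The instances are the degree in T and the total degree. *)
Record grading (A : comNzRingType) (P : nat -> A -> Prop) : Prop := Grading {
  grading0 : forall n, P n 0;
  grading1 : P 0%N 1;
  gradingD : forall n a b, P n a -> P n b -> P n (a + b);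
  gradingN : forall n a, P n a -> P n (- a);
  gradingM : forall n k a b, P n a -> P k b -> P (n + k)%N (a * b);
  grading_leq : forall n k a, (n <= k)%N -> P n a -> P k a }.

(** [Q n a] stands for norm at most n, for a submultiplicative norm; the instance is the sum of the
    absolute values of the coefficients. *)
Record norm_bound (A : comNzRingType) (Q : nat -> A -> Prop) : Prop := NormBound {
  norm_bound0 : Q 0%N 0;
  norm_bound1 : Q 1%N 1;
  norm_boundD : forall n k a b, Q n a -> Q k b -> Q (n + k)%N (a + b);
  norm_boundN : forall n a, Q n a -> Q n (- a);
  norm_boundM : forall n k a b, Q n a -> Q k b -> Q (n * k)%N (a * b);
  norm_bound_leq : forall n k a, (n <= k)%N -> Q n a -> Q k a }.

Lemma grading_det (A : comNzRingType) (P : nat -> A -> Prop) n (M : 'M[A]_n) w :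
  grading P -> (forall i j, P (w i) (M i j)) -> P (\sum_i w i)%N (\det M).
Proof.
move=> [P0 P1 PD PN PM PS] PMw; apply: (big_ind (P _)) => [||s _]; [exact: P0 | exact: PD |].
have Psign : P 0%N ((-1) ^+ s) by case: (s : bool); rewrite ?expr1 ?expr0 //; apply: (PN).
rewrite -[(\sum_i w i)%N]add0n; apply: (PM _ _ _ _ Psign _).
by apply: (big_ind2 (fun n a => P n a)) => // k u l v; apply: (PM).
Qed.

Lemma norm_bound_sum (A : comNzRingType) (Q : nat -> A -> Prop) (I : finType) (F : I -> A) B :
  norm_bound Q -> (forall i, Q B (F i)) -> Q (#|I| * B)%N (\sum_i F i).
Proof.
move=> [Q0 Q1 QD QN QM QS] QF; rewrite -sum_nat_const.
by apply: (big_ind2 (fun n a => Q n a)) => // k u l v; apply: (QD).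
Qed.

Lemma norm_bound_det (A : comNzRingType) (Q : nat -> A -> Prop) n (M : 'M[A]_n) B :
  norm_bound Q -> (forall i j, Q B (M i j)) -> Q (n`! * B ^ n)%N (\det M).
Proof.
move=> Qn QMB; have [Q0 Q1 QD QN QM QS] := Qn.
rewrite -card_Sn; apply: norm_bound_sum => // s.
have Qsign : Q 1%N ((-1) ^+ s) by case: (s : bool); rewrite ?expr1 ?expr0 //; apply: (QN).
rewrite -[(B ^ n)%N]mul1n; apply: (QM _ _ _ _ Qsign _).
rewrite -[n in (B ^ n)%N]card_ord -prod_nat_const.
by apply: (big_ind2 (fun n a => Q n a)) => // k u l v; apply: (QM).
Qed.

Lemma norm_bound_int (A : comNzRingType) (Q : nat -> A -> Prop) (n : int) :
  norm_bound Q -> Q `|n|%N n%:~R.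
Proof.
move=> [Q0 Q1 QD QN QM QS].
have Qnat (k : nat) : Q k k%:R.
  by elim: k => // k IHk; rewrite -addn1 natrD; apply: (QD).
by case: n => k; [apply: (Qnat) | rewrite NegzE rmorphN abszN; apply: (QN); apply: (Qnat)].
Qed.

Lemma mcoeff_monoM n (A : comNzRingType) (p : {mpoly A[n]}) u v :
  ('X_[u] * p)@_v = if (u <= v)%MM then p@_(v - u) else 0.
Proof.
rewrite mulrC; case: ifP => [le_uv|/negP nle_uv].
  by rewrite -[v in LHS](submK le_uv) addmC mcoeffMX.
apply: memN_msupp_eq0; apply/negP; rewrite (perm_mem (msuppMX p u)) => /mapP [w _ vE].
by case: nle_uv; rewrite vE lem_addr.
Qed.

Section Macaulay.
Variables (q D : nat).
Local Notation m := q.+1.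
Variable G : 'I_m -> {mpoly int[m]}.
Hypotheses (D_gt0 : (0 < D)%N) (G_deg : forall k, (msize (G k) <= D.+1)%N).

(** Macaulay's critical degree for m forms of degree D and one of degree 1 is m (D - 1) + 1; one
    more is added because the bound on monomials is strict. *)
Definition mac_bound := (m * D.-1).+2.
Local Notation mon := 'X_{1..m < mac_bound}.

Lemma reduced_mdeg (u : 'X_{1..m}) : (forall k, (D <= u k)%N = false) -> (mdeg u <= m * D.-1)%N.
Proof.
move=> red; rewrite mdegE -[m in (m * _)%N]card_ord -sum_nat_const; apply: leq_sum => k _.
by have := red k; lia.
Qed.

Section Matrix.
Variables (A : idomainType) (b : 'I_m.+1 -> 'I_m -> A) (y : 'I_m.+1 -> A) (z : A).

Definition mac_eqn (i : 'I_m.+1) : {mpoly A[m]} :=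
  deform D G (fun i j => (b i j)%:MP) (fun j => 'X_j) z%:MP i - (y i)%:MP.

(* Only the rows of the monomials reduced modulo all [x_k^D], at most [D^m] of
   them, involve [y ord_max]. *)
Definition mac_row (u : mon) : {mpoly A[m]} :=
  if [pick k | (D <= (u : 'X_{1..m}) k)%N] is Some k
  then 'X_[u - U_(k) *+ D] * mac_eqn (lift ord_max k) else 'X_[u] * mac_eqn ord_max.

Definition mac_mx : 'M[A]_#|{: mon}| :=
  \matrix_(i < #|{: mon}|, j < #|{: mon}|) (mac_row (enum_val i))@_(enum_val j).

Lemma int_evalX (g : {mpoly int[m]}) :
  int_eval (fun j => 'X_j : {mpoly A[m]}) g = map_mpoly (intmul 1) g.
Proof.
apply: (mpoly_hom_ext (f := int_eval (fun j => 'X_j : {mpoly A[m]})) (g := map_mpoly (intmul 1))) => [c|i].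
  rewrite /= map_mpolyC /int_eval mmapC; apply/esym; exact: (rmorph_int (@mpolyC m A)).
by rewrite /= map_mpolyX /int_eval mmapXU.
Qed.

Lemma mac_linear_coef i v :
  (\sum_j (b i j)%:MP * 'X_j - (y i)%:MP : {mpoly A[m]})@_v =
  \sum_j b i j * (U_(j)%MM == v)%:R - y i * (v == 0%MM)%:R.
Proof.
rewrite mcoeffB mcoeffC raddf_sum /=; congr (_ - _).
by apply: eq_bigr => j _; rewrite mcoeffCM mcoeffX.
Qed.

Lemma mac_eqn_coef k v :
  (mac_eqn (lift ord_max k))@_v = z * ((G k)@_v)%:~R + ((U_(k) *+ D)%MM == v)%:R +
    (\sum_j b (lift ord_max k) j * (U_(j)%MM == v)%:R - y (lift ord_max k) * (v == 0%MM)%:R).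
Proof.
rewrite /mac_eqn /deform liftK -addrA mcoeffD mac_linear_coef mcoeffD.
by rewrite mcoeffCM int_evalX mcoeff_map_mpoly mcoeffXn.
Qed.

Lemma mac_eqn_coef_max v :
  (mac_eqn ord_max)@_v = (U_(ord0)%MM == v)%:R +
    (\sum_j b ord_max j * (U_(j)%MM == v)%:R - y ord_max * (v == 0%MM)%:R).
Proof. by rewrite /mac_eqn /deform unlift_none -addrA mcoeffD mac_linear_coef mcoeffX. Qed.

Lemma msize_leP (p : {mpoly A[m]}) n :
  (forall v, (n <= mdeg v)%N -> p@_v = 0) -> (msize p <= n)%N.
Proof.
move=> pz; rewrite msizeE; apply/bigmax_leqP_seq => v; rewrite mcoeff_msupp => pv _.
by rewrite ltnNge; apply: contra pv => /pz ->.
Qed.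

Lemma mac_eqn_size k : (msize (mac_eqn (lift ord_max k)) <= D.+1)%N.
Proof.
apply: msize_leP => v Dv; rewrite mac_eqn_coef.
have v0 : (v == 0%MM) = false by apply: contraTF Dv => /eqP ->; rewrite mdeg0.
have vU j : (U_(j)%MM == v) = false.
  by apply: contraTF Dv => /eqP <-; rewrite mdeg1 -leqNgt.
have vD : ((U_(k) *+ D)%MM == v) = false.
  by apply: contraTF Dv => /eqP <-; rewrite mdegMn mdeg1 mul1n ltnn.
rewrite v0 vD mulr0 subr0 (memN_msupp_eq0 (msize_mdeg_ge _)) ?(leq_trans (G_deg k)) //.
by rewrite mulr0 !add0r big1 // => j _; rewrite vU mulr0.
Qed.

Lemma mac_eqn_size_max : (msize (mac_eqn ord_max) <= 2)%N.
Proof.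
apply: msize_leP => v Dv; rewrite mac_eqn_coef_max.
have v0 : (v == 0%MM) = false by apply: contraTF Dv => /eqP ->; rewrite mdeg0.
have vU j : (U_(j)%MM == v) = false.
  by apply: contraTF Dv => /eqP <-; rewrite mdeg1.
by rewrite v0 vU mulr0 subr0 add0r big1 // => j _; rewrite vU mulr0.
Qed.

Lemma mac_row_size u : (msize (mac_row u) <= mac_bound)%N.
Proof.
rewrite /mac_row; case: pickP => [k Dk|red].
  apply: leq_trans (msizeM_leq _ _) _; rewrite msizeX.
  have le_u : (U_(k) *+ D <= u)%MM.
    apply/mnm_lepP => j; rewrite mulmnE mnm1E; case: eqP => [<-|_]; by rewrite ?mul1n.
  have := mac_eqn_size k; have := bmdeg u.
  have := congr1 (@mdeg m) (submK le_u); rewrite mdegD mdegMn mdeg1 mul1n; lia.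
apply: leq_trans (msizeM_leq _ _) _; rewrite msizeX.
have le_u := reduced_mdeg red.
move: le_u mac_eqn_size_max; rewrite /mac_bound; move: (m * D.-1)%N (msize _) (mdeg _) => M s d; lia.
Qed.

(** The adjugate shows that det M kills every entry of [v]; an entry 1 takes the place of
    cancellation. *)
Lemma det_kernel n (S : comNzRingType) (M : 'M[S]_n) (v : 'I_n -> S) i0 :
  (forall i, \sum_j M i j * v j = 0) -> v i0 = 1 -> \det M = 0.
Proof.
move=> Mv v1; have : \adj M *m (M *m \col_j v j) = 0.
  by rewrite (_ : M *m _ = 0) ?mulmx0 //; apply/colP => i; rewrite !mxE -[RHS](Mv i);
    apply: eq_bigr => j _; rewrite mxE.
rewrite mulmxA mul_adj_mx mul_scalar_mx => /colP /(_ i0).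
by rewrite !mxE v1 mulr1.
Qed.

(** Each row is a multiple of some Y_i - y_i, which vanishes at [x]. So the vector of all monomials
    at [x] lies in the kernel, and its entry at the monomial 1 is 1. *)
Lemma mac_vanish (S : comNzRingType) (h : {rmorphism A -> S}) (x : 'I_m -> S) :
  (forall i, h (y i) = deform D G (fun i j => h (b i j)) x (h z) i) ->
  h (\det mac_mx) = 0.
Proof.
move=> hy; rewrite -det_map_mx.
have eqn0 i : mmap h x (mac_eqn i) = 0.
  have mC c : mmap h x c%:MP = h c by rewrite mmapC.
  have dE : mmap h x (deform D G (fun i j => (b i j)%:MP) (fun j => 'X_j) z%:MP i) = h (y i).
    rewrite (deform_hom D G (mmap h x)) hy /= mC; apply: deform_ext => [i' j|j].
      exact: mC.
    by rewrite /= mmapXU.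
  by rewrite /mac_eqn (rmorphB (mmap h x)) /= dE mC subrr.
have row0 u : mmap h x (mac_row u) = 0.
  by rewrite /mac_row; case: pickP => [k _|_]; rewrite (rmorphM (mmap h x)) /= eqn0 mulr0.
have mon0 : (0 < mac_bound)%N by [].
have d0 : (mdeg (0%MM : 'X_{1..m}) < mac_bound)%N by rewrite mdeg0.
apply: (@det_kernel _ _ _ (fun j => mmap1 x (enum_val j : mon)) (enum_rank (BMultinom d0))).
  move=> i; rewrite -[RHS](row0 (enum_val i)) (mmapE _ (mac_row_size _)).
  rewrite (reindex (@enum_val _ (mem {: mon}))) /=; last first.
    by apply: onW_bij; apply: enum_val_bij.
  by apply: eq_bigr => j _; rewrite !mxE.
by rewrite enum_rankK /= mmap11.
Qed.

(** At a = 0, z = 0, Y = 0, T = 1 the system reads x_k^D = 0, x_0 = 1. The row of a non-reduced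
    monomial u becomes u, that of a reduced one x_0 u - u. A kernel vector thus vanishes at
    non-reduced monomials and agrees at u and x_0 u for reduced u; multiplying by x_0 until the
    exponent is D ends at a non-reduced one. *)
Lemma mac_neq0 (h : {rmorphism A -> int}) :
  (forall i j, h (b i j) = 0) -> h z = 0 ->
  (forall i, h (y i) = (i == ord_max)%:R) -> \det mac_mx != 0.
Proof.
move=> hb hz hy; suff : h (\det mac_mx) != 0 by apply: contra_neq => ->; rewrite rmorph0.
rewrite -det_map_mx -det_tr; apply/det0P => -[v v0 vM].
pose w (u : mon) : int := v 0 (enum_rank u).
have wM (u : mon) : \sum_(t : mon) h ((mac_row u)@_t) * w t = 0.
  have := congr1 (fun r : 'rV_ _ => r 0 (enum_rank u)) vM; rewrite !mxE => vMu.
  rewrite -[RHS]vMu (reindex (@enum_val _ (mem {: mon}))) /=; last first.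
    by apply: onW_bij; apply: enum_val_bij.
  by apply: eq_bigr => j _; rewrite !mxE enum_rankK /w enum_valK mulrC.
have hk k t : h ((mac_eqn (lift ord_max k))@_t) = ((U_(k) *+ D)%MM == t)%:R.
  rewrite mac_eqn_coef !rmorphD rmorphM hz mul0r add0r rmorph_nat rmorphN rmorphM hy.
  rewrite [lift _ _ == _]eq_sym (negbTE (neq_lift _ _)) mul0r subr0 rmorph_sum big1 ?addr0 // => j _.
  by rewrite rmorphM hb mul0r.
have hmax t : h ((mac_eqn ord_max)@_t) = (U_(ord0)%MM == t)%:R - (t == 0%MM)%:R.
  rewrite mac_eqn_coef_max !rmorphD rmorph_nat rmorphN rmorphM hy eqxx mul1r rmorph_nat.
  by rewrite rmorph_sum big1 ?add0r // => j _; rewrite rmorphM hb mul0r.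
suff w0 (u : mon) : w u = 0.
  case/rV0Pn: v0 => i /negP []; apply/eqP.
  by have := w0 (enum_val i); rewrite /w enum_valK.
have [n] := ubnP (D - (u : 'X_{1..m}) ord0); elim: n u => // n IHn u ltn.
have := wM u; rewrite /mac_row; case: pickP => [k Dk|red].
  have le_u : (U_(k) *+ D <= u)%MM.
    apply/mnm_lepP => j; rewrite mulmnE mnm1E; case: eqP => [<-|_]; by rewrite ?mul1n.
  rewrite (bigD1 u) //= big1 ?addr0.
    rewrite mcoeff_monoM lem_subr hk (_ : (_ == _) = true) ?mul1r //.
    by rewrite submBA // addmC addmK eqxx.
  move=> t ne_tu; rewrite mcoeff_monoM; case: ifP => le_t; rewrite ?rmorph0 ?mul0r //.
  rewrite hk; case: eqP => [e|_]; rewrite ?mul0r //; case/negP: ne_tu.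
  by rewrite bmeqP -(submK le_t) -e addmC submK.
have du : (mdeg (u + U_(ord0))%MM < mac_bound)%N.
  by rewrite mdegD mdeg1 /mac_bound addn1 !ltnS reduced_mdeg.
rewrite (bigD1 u) //= (bigD1 (BMultinom du)) /=; last first.
  rewrite bmeqP /= -{2}[bmnm u]addm0 eqm_add2l; apply/eqP => /(congr1 (@mdeg m)).
  by rewrite mdeg1 mdeg0.
rewrite big1 ?addr0.
  have uu : (bmnm u - u)%MM = 0%MM by apply/mnmP => j; rewrite mnmBE mnm0E subnn.
  rewrite !mcoeff_monoM lepm_refl uu lem_addr hmax eqxx mnm1_eq0 sub0r mulN1r.
  have -> : (u + U_(ord0) - u = U_(ord0))%MM by rewrite addmC addmK.
  rewrite hmax eqxx mnm1_eq0 subr0 mul1r => /eqP.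
  rewrite addrC subr_eq0 => /eqP <-; apply: IHn => /=.
  rewrite mnmDE mnm1E eqxx; have := red ord0; move: ltn; lia.
move=> t /andP [ne_tu ne_tu0]; rewrite mcoeff_monoM; case: ifP => le_t; rewrite ?rmorph0 ?mul0r //.
rewrite hmax; case: eqP => [e|_].
  by case/negP: ne_tu0; rewrite bmeqP /= e addmC submK.
case: eqP => [e|_]; rewrite ?subr0 ?mul0r //.
by case/negP: ne_tu; rewrite bmeqP -(submK le_t) e add0m.
Qed.

Lemma card_reduced :
  (#|[pred u : mon | [pick k | (D <= (u : 'X_{1..m}) k)%N] == None]| <= D ^ m)%N.
Proof.
have [d0|d0] := posnP D; first by move: D_gt0; rewrite d0.
pose g (u : mon) : {ffun 'I_m -> 'I_D.-1.+1} := [ffun i => inord (u i)].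
have red (u : mon) : [pick k | (D <= (u : 'X_{1..m}) k)%N] == None -> forall k, (u k < D.-1.+1)%N.
  by case: pickP => // r _ k; rewrite prednK // ltnNge r.
rewrite -[D in (D ^ _)%N]prednK // -[D.-1.+1]card_ord -[m in (_ ^ m)%N]card_ord -card_ffun.
apply: (@leq_card_in _ _ g) => u v; rewrite !inE => /red ru /red rv /ffunP e.
apply/eqP; rewrite bmeqP; apply/eqP/mnmP => k.
by have := e k; rewrite !ffunE => /(congr1 val); rewrite /= !inordK.
Qed.

Lemma mac_grading (P : nat -> A -> Prop) : grading P ->
  (forall i j, P 0%N (b i j)) -> P 0%N z ->
  (forall i, P (i == ord_max) (y i)) -> P (D ^ m)%N (\det mac_mx).
Proof.
move=> Pg Pb Pz Py; have [P0 P1 PD PN PM PS] := Pg.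
have Pint (n : int) : P 0%N n%:~R.
  have Pnat (k : nat) : P 0%N k%:R.
    by elim: k => // k IHk; rewrite -addn1 natrD; apply: (PD).
  by case: n => k; [apply: Pnat | rewrite NegzE rmorphN; apply: (PN); apply: Pnat].
have Psum i v : P 0%N (\sum_j b i j * (U_(j)%MM == v)%:R).
  apply: (big_ind (P 0%N)) => // [? ?|j _]; first exact: PD.
  by apply: (PM 0%N 0%N) => //; apply: (Pint _%:Z).
have Pk k v : P 0%N ((mac_eqn (lift ord_max k))@_v).
  rewrite mac_eqn_coef; apply: (PD); first apply: (PD).
  - exact: (PM 0%N 0%N).
  - exact: (Pint _%:Z).
  - apply: (PD) => //; apply: (PN); apply: (PM 0%N 0%N); last exact: (Pint _%:Z).
    by have := Py (lift ord_max k); rewrite eq_sym (negbTE (neq_lift _ _)).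
have Pmax v : P 1%N ((mac_eqn ord_max)@_v).
  rewrite mac_eqn_coef_max; apply: (PD); first by apply: PS (Pint _%:Z).
  apply: (PD); first by apply: PS (Psum _ _).
  apply: (PN); apply: (PM 1%N 0%N); last exact: (Pint _%:Z).
  by have := Py ord_max; rewrite eqxx.
pose w (u : mon) : nat := [pick k | (D <= (u : 'X_{1..m}) k)%N] == None.
have Pw : P (\sum_(i < #|{: mon}|) w (enum_val i))%N (\det mac_mx).
  apply: (grading_det Pg) => // i j; rewrite mxE /mac_row /w.
  case: pickP => [k _|_]; rewrite /= mcoeff_monoM; case: ifP => _ //; exact: PS (P0 0%N).
apply: PS Pw; apply: leq_trans card_reduced.
rewrite -[X in (_ <= X)%N]sum1_card [X in (_ <= X)%N]big_mkcond /= (reindex (@enum_val _ (mem {: mon}))) /=; last first.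
  by apply: onW_bij; apply: enum_val_bij.
by apply: leq_sum => i _; rewrite /w inE; case: eqP.
Qed.

Lemma mac_norm_bound (Q : nat -> A -> Prop) H : norm_bound Q ->
  (forall i j, Q 1%N (b i j)) -> Q 1%N z -> (forall i, Q 1%N (y i)) ->
  (forall k v, (`|(G k)@_v| <= H)%N) ->
  Q ((#|{: mon}|)`! * (H + m + 2) ^ #|{: mon}|)%N (\det mac_mx).
Proof.
move=> Qn Qb Qz Qy GH; have [Q0 Q1 QD QN QM QS] := Qn.
have Qbool (c : bool) : Q 1%N c%:R by case: c => //; apply: QS Q0.
have Qsum i v : Q m (\sum_j b i j * (U_(j)%MM == v)%:R).
  have : Q (#|'I_m| * 1)%N (\sum_j b i j * (U_(j)%MM == v)%:R).
    by apply: norm_bound_sum => // j; apply: (QM 1%N 1%N).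
  by rewrite card_ord muln1.
have Qlin i v : Q (m + 1)%N (\sum_j b i j * (U_(j)%MM == v)%:R - y i * (v == 0%MM)%:R).
  by apply: (QD) => //; apply: (QN); apply: (QM 1%N 1%N).
(* H for z G_k, 1 for x_k^D, m for the linear form and 1 for y_k. *)
have Qk k v : Q (H + m + 2)%N ((mac_eqn (lift ord_max k))@_v).
  rewrite mac_eqn_coef (_ : H + m + 2 = (1 * H + 1) + (m + 1))%N; last by lia.
  apply: (QD) => //; apply: (QD) => //; apply: (QM) => //.
  exact: QS (GH k v) (norm_bound_int _ Qn).
have Qmax v : Q (H + m + 2)%N ((mac_eqn ord_max)@_v).
  rewrite mac_eqn_coef_max; apply: QS (QD _ _ _ _ (Qbool _) (Qlin _ _)); lia.
apply: norm_bound_det => // i j; rewrite mxE /mac_row.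
case: pickP => [k _|_]; rewrite mcoeff_monoM; case: ifP => _ //; exact: QS Q0.
Qed.

End Matrix.
End Macaulay.

(** * Relations between the deformed forms *)

Section DeformedRing.
Variables (n : nat) (L : comNzRingType).

(* [L[Y_0, ..., Y_n, z]] as polynomials in [Y_0]; variable [0] of the
   coefficients is [z] and variable [i.+1] is [Y_i.+1].  Singling out [Y_0] makes
   the greatest common divisor a univariate one. *)
Definition deform_ring := {poly {mpoly L[n.+1]}}.
Definition dC (c : L) : deform_ring := (c%:MP)%:P.
Definition dY (i : 'I_n.+1) : deform_ring :=
  on_cons ('X : deform_ring) (fun k : 'I_n => ('X_(lift ord0 k))%:P) i.
Definition dz : deform_ring := ('X_ord0)%:P.

HB.instance Definition _ := GRing.ComNzRing.on deform_ring.
HB.instance Definition _ := GRing.RMorphism.copy dC (polyC \o @mpolyC n.+1 L).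

Lemma deform_ring_ext (S : comNzRingType) (f g : {rmorphism deform_ring -> S}) :
  (forall c, f (dC c) = g (dC c)) -> (forall i, f (dY i) = g (dY i)) -> f dz = g dz -> f =1 g.
Proof.
move=> fgC fgY fgz; apply: poly_hom_ext => [p|]; last first.
  by have := fgY ord0; rewrite /dY on_cons0.
apply: (mpoly_hom_ext (f := f \o polyC) (g := g \o polyC)) => [c|i] /=; first exact: fgC.
case: (unliftP ord0 i) => [k|] ->; last exact: fgz.
by have := fgY (lift ord0 k); rewrite /dY on_consS.
Qed.

Section Hom.
Variables (S : comNzRingType) (l : {rmorphism L -> S}) (y : 'I_n.+1 -> S) (z : S).

Definition dhom : deform_ring -> S :=
  horner_eval (y ord0) \o map_poly (mmap l (on_cons z (fun k => y (lift ord0 k)))).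
HB.instance Definition _ := GRing.RMorphism.on dhom.

Lemma dhomP p : dhom p%:P = mmap l (on_cons z (fun k => y (lift ord0 k))) p.
Proof. by rewrite /dhom /= map_polyC /horner_eval hornerC. Qed.

Lemma dhomC c : dhom (dC c) = l c.
Proof. by rewrite /dC dhomP mmapC. Qed.

Lemma dhomz : dhom dz = z.
Proof. by rewrite /dz dhomP mmapXU on_cons0. Qed.

Lemma dhomY i : dhom (dY i) = y i.
Proof.
case: (unliftP ord0 i) => [k|] ->.
  by rewrite /dY on_consS dhomP mmapXU on_consS.
by rewrite /dY on_cons0 /dhom /= map_polyX /horner_eval hornerX.
Qed.

End Hom.
End DeformedRing.

HB.instance Definition _ n (L : idomainType) := GRing.IntegralDomain.on (deform_ring n L).

Lemma factor_out_X (A : idomainType) (p : {poly A}) : p != 0 ->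
  exists k r, p = r * 'X^k /\ r.[0] != 0.
Proof.
move=> p0; have [k [r /implyP r0 pE]] := multiplicity_XsubC p 0.
by exists k, r; split; [rewrite pE subr0 | apply: r0].
Qed.

Section Certificate.
Variables (q D : nat).
Local Notation m := q.+1.
Variable G : 'I_m -> {mpoly int[m]}.
Variables (L : idomainType) (a : 'I_m.+1 -> 'I_m -> L).
Hypotheses (aP : free_params a) (D_gt0 : (0 < D)%N).

Local Notation B := {mpoly L[m.+1]}.
Local Notation W := (deform_ring m L).
Local Notation gx := (@genx q L).
Local Notation gz := (@genz q L).
Local Notation gY := (genY D G a).

Definition gen_eval : W -> B := dhom (@mpolyC m.+1 L) gY gz.
HB.instance Definition _ := GRing.RMorphism.on gen_eval.

(* Scaling the parameters and [z] by a variable ['X] and looking at the lowest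
   order term in ['X] degenerates [Y_i] to the monomials [x_i^D] and [x_0]. *)
Lemma degenerate_inj (p : B) : p != 0 ->
  mmap (@mpolyC m.+1 L)
    (on_cons gz (fun k => deform D G (fun _ _ => 0) gx 0 (lift ord0 k))) p != 0.
Proof.
move=> p0; set h := mmap _ _.
have natL := free_params_nat aP.
pose val (i : 'I_m.+1) (k : nat) : L :=
  if unlift ord0 i is Some j then
    if unlift ord_max (lift ord0 j) is Some _ then (k ^ D)%:R else k%:R
  else k%:R.
have [|N pN] := mpoly_nonroot (s := val) _ p0.
  move=> i k l; rewrite /val; case: unlift => [j|]; last exact: natL.
  by case: unlift => [_|] /natL // /eqP; rewrite eqn_exp2r // => /eqP.
(* x_j receives the test value of the variable that degenerates to a power of x_j: Y_j for j > 0,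
   but T for x_0, as Y_0 is not a variable of [p]. Accordingly [val] takes D-th powers except at z
   and T. *)
pose x (j : 'I_m) : L := (if unlift ord0 (lift ord_max j) is Some k then N (lift ord0 k)
   else N (lift ord0 ord_max))%:R.
pose v := on_cons (N ord0)%:R x.
suff hE : (h p).@[v] = p.@[fun i => val i (N i)].
  by apply: contraNneq pN => hp; rewrite -hE hp meval0.
apply: (mpoly_hom_ext (f := meval v \o h) (g := meval (fun i => val i (N i)))) => [c|i] /=.
  by rewrite /h mmapC !mevalC.
rewrite /h mmapXU mevalXU /val; case: (unliftP ord0 i) => [k|] ->; last first.
  by rewrite on_cons0 /genz mevalXU /v on_cons0.
rewrite on_consS (deform_hom D G (meval v)) /deform big1 ?addr0; last first.
  by move=> j _; rewrite /= meval0 mul0r.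
have vx j : v (lift ord0 j) = x j by rewrite /v on_consS.
case: (unliftP ord_max (lift ord0 k)) => [j kj|kmax] /=.
  by rewrite meval0 mul0r add0r /genx mevalXU vx /x -kj liftK natrX.
rewrite /genx mevalXU vx /x; case: (unliftP ord0 (lift ord_max ord0)) => [j /(congr1 val)|_] //.
by congr (N _)%:R; apply: val_inj; rewrite kmax.
Qed.

(** The coefficients of [p] lie in L and contain parameters too, so setting a = 0 and z = 0 outright
    could kill [p]. They are scaled along with the forms, and only the lowest order term is
    specialised. The type B serves twice, as L[z, x] and as the coefficient ring
    L[z, Y_1, ..., T]. *)
Lemma gen_eval_inj (p : B) : p != 0 -> gen_eval p%:P != 0.
Proof.
move=> p0; rewrite /gen_eval dhomP.
have [l lE] := free_lift aP (fun i j => 'X * ((a i j)%:MP : B)%:P).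
have [scale [scaleC scalez scaleS]] : exists scale : {rmorphism B -> {poly B}},
    [/\ forall c, scale c%:MP = l c, scale gz = 'X * gz%:P &
        forall k, scale 'X_(lift ord0 k) = ('X_(lift ord0 k))%:P].
  exists (mmap l (on_cons ('X * gz%:P) (fun k => ('X_(lift ord0 k))%:P))).
  by split=> [c||k] /=; rewrite /genz ?mmapC ?mmapXU ?on_cons0 ?on_consS.
have at1 b : (scale b).[1] = b.
  apply: (mpoly_hom_ext (f := horner_eval 1 \o scale) (g := idfun)) => [c|i].
    rewrite [LHS]/= scaleC /horner_eval.
    apply: (free_ext aP (h := horner_eval 1 \o l) (h' := @mpolyC m.+1 L)) => i j.
    by rewrite /= lE /horner_eval hornerM hornerX hornerC mul1r.
  rewrite [LHS]/= /horner_eval; case: (unliftP ord0 i) => [k|] ->.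
    by rewrite scaleS hornerC.
  by rewrite scalez hornerM hornerX hornerC mul1r.
have sp0 : scale p != 0 by apply: contraNneq p0 => sp; rewrite -(at1 p) sp horner0.
pose y (i : 'I_m.+1) := scale (gY i).
(* [H] substitutes the scaled forms for the formal variables without scaling anything else, so
   scaling after substitution is [H] after scaling. *)
have [H [HX HP]] : exists H : {rmorphism {poly B} -> {poly B}}, H 'X = 'X /\
    forall b, H b%:P = mmap (polyC \o @mpolyC m.+1 L) (on_cons gz%:P (fun k => y (lift ord0 k))) b.
  exists (horner_eval 'X \o
    map_poly (mmap (polyC \o @mpolyC m.+1 L) (on_cons gz%:P (fun k => y (lift ord0 k))))).
  split=> [|b] /=; first by rewrite map_polyX /horner_eval hornerX.
  by rewrite map_polyC /horner_eval hornerC.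
suff : scale (mmap (@mpolyC m.+1 L) (on_cons gz (fun k => gY (lift ord0 k))) p) != 0.
  by apply: contraNneq => ->; rewrite rmorph0.
have -> : scale (mmap (@mpolyC m.+1 L) (on_cons gz (fun k => gY (lift ord0 k))) p) = H (scale p).
  apply: (mpoly_hom_ext (f := scale \o mmap (@mpolyC m.+1 L) (on_cons gz (fun k => gY (lift ord0 k))))
    (g := H \o scale)) => [c|i].
    rewrite [LHS]/= mmapC [RHS]/= !scaleC.
    apply: (free_ext aP (h := l) (h' := H \o l)) => i j.
    by rewrite [RHS]/= lE (rmorphM H) HX HP mmapC /=; reflexivity.
  rewrite [LHS]/= mmapXU [RHS]/=; case: (unliftP ord0 i) => [k|] ->.
    by rewrite on_consS scaleS HP mmapXU on_consS.
  by rewrite on_cons0 scalez rmorphM HX HP /genz mmapXU on_cons0.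
have [e [r [rE r0]]] := factor_out_X sp0.
rewrite rE rmorphM rmorphXn HX mulf_neq0 ?expf_neq0 ?polyX_eq0 //.
suff : (H r).[0] != 0 by apply: contraNneq => ->; rewrite horner0.
suff -> : (H r).[0] = mmap (@mpolyC m.+1 L)
    (on_cons gz (fun k => deform D G (fun _ _ => 0) gx 0 (lift ord0 k))) r.[0].
  exact: degenerate_inj.
apply: (poly_hom_ext (f := horner_eval 0 \o H) (g := mmap (@mpolyC m.+1 L)
   (on_cons gz (fun k => deform D G (fun _ _ => 0) gx 0 (lift ord0 k))) \o horner_eval 0)) => [b|].
  rewrite [LHS]/= HP [RHS]/= /horner_eval hornerC.
  apply: (mpoly_hom_ext (f := horner_eval 0 \o mmap (polyC \o @mpolyC m.+1 L)
     (on_cons gz%:P (fun k => y (lift ord0 k))))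
     (g := mmap (@mpolyC m.+1 L) (on_cons gz (fun k => deform D G (fun _ _ => 0) gx 0 (lift ord0 k))))) => [c|i].
    by rewrite [LHS]/= mmapC [LHS]/= /horner_eval hornerC [RHS]mmapC.
  rewrite [LHS]/= !mmapXU /horner_eval; case: (unliftP ord0 i) => [k|] ->.
    rewrite !on_consS /y /genY (deform_hom D G scale) scalez.
    rewrite -[LHS]/(horner_eval 0 _) (deform_hom D G (horner_eval 0)).
    rewrite [X in deform _ _ _ _ X _](_ : _ = 0); last by rewrite /= /horner_eval hornerM hornerX mul0r.
    rewrite [RHS]mmapXU on_consS; apply: deform_ext => [i' j|j].
      by rewrite scaleC lE /= /horner_eval hornerM hornerX mul0r.
    by rewrite /= /genx scaleS /horner_eval hornerC.
  by rewrite [RHS]mmapXU !on_cons0 hornerC.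
by rewrite [LHS]/= HX [RHS]/= /horner_eval hornerX rmorph0.
Qed.

End Certificate.

Lemma polyC_factor (A : idomainType) (p r : {poly A}) c :
  p * r = c%:P -> c != 0 -> exists d, p = d%:P.
Proof.
move=> e c0; have pr0 : p * r != 0 by rewrite e polyC_eq0.
have [p0 r0] : p != 0 /\ r != 0 by move: pr0; rewrite mulf_eq0 negb_or => /andP.
have := size_mul p0 r0; rewrite e size_polyC c0 => sz.
exists p`_0; apply: size1_polyC; move: sz; rewrite -size_poly_gt0 in p0; rewrite -size_poly_gt0 in r0.
by move: p0 r0; case: (size p) => // k; case: (size r) => // l _ _; rewrite addnS /= => -[/esym/eqP]; rewrite addn_eq0 => /andP [/eqP ->].
Qed.

Section Theta.
Variables (n : nat) (L : comNzRingType).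
Local Notation W := (deform_ring n L).

(* [theta w] is [w] as a polynomial in [z]; [kappa w = w] says that [w] only
   involves [Y_ord_max]. *)
Definition theta : W -> {poly W} := dhom (polyC \o @dC n L) (fun i => (dY L i)%:P) 'X.
HB.instance Definition _ := GRing.RMorphism.on theta.

Definition kappa : deform_ring n.+1 L -> deform_ring n.+1 L :=
  dhom (@dC n.+1 L) (fun i => if i == ord_max then dY L i else 0) 0.
HB.instance Definition _ := GRing.RMorphism.on kappa.

End Theta.

Section Certificate.
Variables (q D : nat).
Local Notation m := q.+1.
Variable G : 'I_m -> {mpoly int[m]}.
Variables (L : idomainType) (a : 'I_m.+1 -> 'I_m -> L).
Hypotheses (aP : free_params a) (D_gt0 : (0 < D)%N) (L_factorial : factorial_ring L).
Hypothesis coordP : forall j, exists (psi : {poly int}) (g : 'I_m -> {mpoly int[m]}),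
    psi != 0 /\ poly_at 'X_j psi = \sum_i g i * G i.

Local Notation C := {mpoly L[m.+1]}.
Local Notation W := (deform_ring m L).
Local Notation ev := (gen_eval D G a).

Definition inclY : C -> W := mmap (@dC m L) (@dY m L).
HB.instance Definition _ := GRing.RMorphism.on inclY.

Lemma inclYC c : inclY c%:MP = dC m c.
Proof. by rewrite /inclY mmapC. Qed.

Lemma inclYX i : inclY 'X_i = dY L i.
Proof. by rewrite /inclY mmapXU. Qed.

Lemma inclY_inj : injective inclY.
Proof.
apply: (can_inj (g := dhom (@mpolyC m.+1 L) (fun i => 'X_i) 0)).
apply: (mpoly_hom_ext (f := dhom (@mpolyC m.+1 L) (fun i => 'X_i) 0 \o inclY) (g := idfun)) => [c|i].
  by rewrite [LHS]/= inclYC dhomC.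
by rewrite [LHS]/= inclYX dhomY.
Qed.

Lemma ev_inclY c : ev (inclY c) = subY D G a c.
Proof.
apply: (mpoly_hom_ext (f := ev \o inclY) (g := subY D G a)) => [d|i].
  by rewrite [LHS]/= inclYC /gen_eval dhomC [RHS]/= subYC.
by rewrite [LHS]/= inclYX /gen_eval dhomY [RHS]/= subYX.
Qed.

Lemma theta_inclY c : theta (inclY c) = (inclY c)%:P.
Proof.
apply: (mpoly_hom_ext (f := @theta m L \o inclY) (g := polyC \o inclY)) => [d|i].
  by rewrite [LHS]/= [RHS]/= inclYC /theta dhomC.
by rewrite [LHS]/= [RHS]/= inclYX /theta dhomY.
Qed.

Lemma eval_const_T_neq0 (c : L) (s : {poly L}) : c != 0 -> s != 0 ->
  c%:MP * (map_poly (@mpolyC m.+1 L) s).['X_ord_max] != 0.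
Proof.
move=> c0 s0; pose f : {rmorphism C -> {poly L}} := mmap polyC (fun=> 'X).
have fE : f (c%:MP * (map_poly (@mpolyC m.+1 L) s).['X_ord_max]) = c%:P * s.
  rewrite (rmorphM f) -(horner_map f) -map_poly_comp /f [X in X * _]mmapC [X in _.[X]]mmapXU.
  congr (_ * _); rewrite -[RHS]comp_polyXr /comp_poly; congr (_.[_]).
  by apply: eq_map_poly => d; rewrite [LHS]/= mmapC.
suff : f (c%:MP * (map_poly (@mpolyC m.+1 L) s).['X_ord_max]) != 0.
  by apply: contraNneq => ->; rewrite rmorph0.
by rewrite fE mulf_neq0 // polyC_eq0.
Qed.

(* Scales [z] and all [Y_i] but the last by ['X]: an element with constant image
   is fixed by [kappa], and a factor of a constant is constant. *)
Definition eta : W -> {poly W} :=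
  dhom (polyC \o @dC m L) (fun i => if i == ord_max then (dY L i)%:P else 'X * (dY L i)%:P)
   ('X * (dz m L)%:P).
HB.instance Definition _ := GRing.RMorphism.on eta.

Lemma eta1 w : (eta w).[1] = w.
Proof.
apply: (deform_ring_ext (f := horner_eval 1 \o eta) (g := idfun)) => [c|i|].
- by rewrite [LHS]/= /eta dhomC /horner_eval hornerC.
- rewrite [LHS]/= /eta dhomY /horner_eval; case: ifP => _; first by rewrite hornerC.
  by rewrite hornerM hornerX mul1r hornerC.
- by rewrite [LHS]/= /eta dhomz /horner_eval hornerM hornerX mul1r hornerC.
Qed.

Lemma eta0 w : (eta w).[0] = kappa w.
Proof.
apply: (deform_ring_ext (f := horner_eval 0 \o eta) (g := @kappa q L)) => [c|i|].
- by rewrite [LHS]/= /eta dhomC /horner_eval hornerC [RHS]/= /kappa dhomC.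
- rewrite [LHS]/= /eta dhomY [RHS]/= /kappa dhomY /horner_eval; case: ifP => _; first by rewrite hornerC.
  by rewrite hornerM hornerX mul0r.
- by rewrite [LHS]/= /eta dhomz [RHS]/= /kappa dhomz /horner_eval hornerM hornerX mul0r.
Qed.

Lemma inclY_constT (S : comNzRingType) (f : {rmorphism W -> S}) c s :
  f (inclY (c%:MP * (map_poly (@mpolyC m.+1 L) s).['X_ord_max])) =
  f (dC m c) * (map_poly (f \o @dC m L) s).[f (dY L ord_max)].
Proof.
rewrite (rmorphM inclY) (rmorphM f) /= inclYC -(horner_map inclY) -(horner_map f).
rewrite -!map_poly_comp /= inclYX; congr (_ * _.[_]).
by apply: eq_map_poly => d; rewrite [LHS]/= inclYC.
Qed.

Lemma eta_constT (c : L) (s : {poly L}) :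
  eta (inclY (c%:MP * (map_poly (@mpolyC m.+1 L) s).['X_ord_max])) =
  (inclY (c%:MP * (map_poly (@mpolyC m.+1 L) s).['X_ord_max]))%:P.
Proof.
rewrite (inclY_constT eta) (inclY_constT polyC) /= /eta dhomC dhomY eqxx.
congr (_ * _.[_]); apply: eq_map_poly => d; by rewrite [LHS]/= dhomC.
Qed.

Lemma certificate (R : W) : R != 0 -> ev R = 0 ->
  exists E e1 : W, [/\ ev E = 0, lead_coef (theta R) = lead_coef (theta E) * e1 &
    kappa (lead_coef (theta E)) = lead_coef (theta E)].
Proof.
move=> R0 evR; have [t [c [s [p [c0 s0 tE p_monic pz]]]]] := genzT_integral D aP coordP.
(* The coefficients of [p] are free of z and [p] is monic, so the leading coefficient of [S] in z is
   the power t^(deg p), where t = c s(T). *)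
pose S : W := (map_poly inclY p).[inclY t * dz m L].
have evS : ev S = 0.
  rewrite -[RHS]pz /S -(horner_map ev) -map_poly_comp (rmorphM ev) /= ev_inclY.
  rewrite {2}/gen_eval dhomz; congr (_.[_]).
  by apply: eq_map_poly => d; rewrite [LHS]/= ev_inclY.
have t0 : inclY t != 0.
  by rewrite raddf_eq0; [rewrite tE; apply: eval_const_T_neq0 | apply: inclY_inj].
have lS : lead_coef (theta S) = inclY t ^+ (size p).-1.
  have -> : theta S = map_poly inclY p \Po ((inclY t)%:P * 'X).
    rewrite /S -(horner_map (@theta m L)) (rmorphM (@theta m L)) /= theta_inclY {2}/theta dhomz.
    rewrite /comp_poly -!map_poly_comp; congr (_.[_]).
    by apply: eq_map_poly => d; rewrite [LHS]/= theta_inclY.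
  have pi_monic : map_poly inclY p \is monic by apply: monic_map.
  rewrite lead_coef_comp; last by rewrite mul_polyC size_scale // size_polyX.
  rewrite (monicP pi_monic) mul1r lead_coefM lead_coefC lead_coefX mulr1.
  by rewrite (size_map_inj_poly inclY_inj (rmorph0 inclY)).
have S0 : S != 0.
  apply: contraNneq (expf_neq0 (size p).-1 t0) => S0.
  by rewrite -lS S0 rmorph0 lead_coef0.
have PF : factorial_ring {mpoly L[m.+1]} by apply: factorial_mpoly.
have [E [[S1 SE] [R1 RE] [d [u [v [d0 dE]]]]]] := common_factor PF (R : {poly {mpoly L[m.+1]}}) S0.
exists E, (lead_coef (theta (R1 : W))); split.
(* The Bezout constant [d] is free of Y_0, so [gen_eval_inj] keeps its value nonzero, and [E] itself
   must evaluate to 0. *)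
- have /eqP := congr1 ev dE.
  rewrite (rmorphM ev) (rmorphD ev) (rmorphM ev u S) (rmorphM ev v R) /= evS evR !mulr0 addr0 mulf_eq0.
  by rewrite (negbTE (gen_eval_inj G aP D_gt0 d0)) => /eqP.
- by rewrite {1}(RE : R = E * R1 :> W) (rmorphM (@theta m L)) lead_coefM.
- set e := lead_coef _.
  have eE : e * lead_coef (theta (S1 : W)) = inclY t ^+ (size p).-1.
    by rewrite -lS (SE : S = E * S1 :> W) (rmorphM (@theta m L)) lead_coefM.
  have etaE : eta e * eta (lead_coef (theta (S1 : W))) = (inclY t ^+ (size p).-1)%:P.
    by rewrite -(rmorphM eta) eE (rmorphXn eta) /= tE eta_constT -(rmorphXn polyC).
  have [g gE] := polyC_factor etaE (expf_neq0 _ t0).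
  by rewrite -eta0 -[RHS]eta1 gE !hornerC.
Qed.

End Certificate.

(** The outer variable will be z and the inner one T: the filtration bounds the degree in T of every
    coefficient of a power of z. *)
Lemma coef_size_grading (A A' : comNzRingType) (F : {rmorphism A -> {poly {poly A'}}}) :
  grading (fun n a => forall i, (size ((F a)`_i)%R <= n.+1)%N).
Proof.
split.
- by move=> n i; rewrite rmorph0 coef0 size_poly0.
- by move=> i; rewrite rmorph1 coef1; case: (_ == _); rewrite ?size_poly1 ?size_poly0.
- move=> n a b Fa Fb i; rewrite rmorphD coefD (leq_trans (size_polyD _ _)) //.
  by rewrite geq_max Fa Fb.
- by move=> n a Fa i; rewrite rmorphN coefN size_polyN.
- move=> n k a b Fa Fb i; rewrite rmorphM coefM (leq_trans (size_sum _ _ _)) //.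
  apply/bigmax_leqP => j _; apply: leq_trans (size_polyMleq _ _) _.
  have := Fa j; have := Fb (i - j)%N; rewrite -ltnS.
  by move: (size _) (size _) => s t; rewrite -subn1 leq_subLR => hs ht;
    rewrite add1n -addSn -addnS leq_add.
- by move=> n k a nk Fa i; apply: leq_trans (Fa i) _.
Qed.

Lemma size_natr_bool (A : nzRingType) (b : bool) : (size (b%:R : {poly A}) <= 1)%N.
Proof. by case: b; rewrite ?size_poly1 ?size_poly0. Qed.

Lemma size_factor_leq (A : idomainType) (p r : {poly A}) :
  r != 0 -> (size p <= size (p * r)%R)%N.
Proof.
move=> r0; have [->|p0] := eqVneq p 0; first by rewrite size_poly0.
by rewrite size_mul // -[size r]prednK ?size_poly_gt0 // addnS leq_addr.
Qed.

(** * Counting zeros modulo a prime *)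

Section Counting.
Variables (q D : nat).
Local Notation m := q.+1.
Variable G : 'I_m -> {mpoly int[m]}.
Variables (L L' : idomainType) (K : comNzRingType) (a : 'I_m.+1 -> 'I_m -> L).
Variables (red : {rmorphism L -> L'}) (emb : {rmorphism K -> L'}).
Hypotheses (D_gt0 : (0 < D)%N) (G_deg : forall k, (msize (G k) <= D.+1)%N).

Local Notation W := (deform_ring m L).
Local Notation W' := (deform_ring m L').

Definition macR : W := \det (mac_mx D G (fun i j => dC m (a i j)) (@dY m L) (dz m L)).

Definition redW : W -> W' := dhom (@dC m L' \o red) (@dY m L') (dz m L').
HB.instance Definition _ := GRing.RMorphism.on redW.

(* [chi w] is the image of [w] under [red] as a polynomial in [Y_ord_max]. *)
Definition chi : W -> {poly W'} :=
  dhom (polyC \o @dC m L' \o red) (fun i => if i == ord_max then 'X else (dY L' i)%:P)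
    (dz m L')%:P.
HB.instance Definition _ := GRing.RMorphism.on chi.

Lemma macR_size : (size (chi (lead_coef (theta macR))) <= (D ^ m).+1)%N.
Proof.
pose F : {rmorphism W -> {poly {poly W'}}} := map_poly chi \o @theta m L.
have Fg := coef_size_grading F.
have Pb i j k : (size ((F (dC m (a i j)))`_k)%R <= 1)%N.
  rewrite [F _]/= /theta dhomC /= map_polyC /= coefC; case: ifP => _; last by rewrite size_poly0.
  by rewrite /chi dhomC size_polyC_leq1.
have Pz k : (size ((F (dz m L))`_k)%R <= 1)%N.
  rewrite [F _]/= /theta dhomz map_polyX coefX; exact: size_natr_bool.
have Py i k : (size ((F (dY L i))`_k)%R <= (i == ord_max).+1)%N.
  rewrite [F _]/= /theta dhomY map_polyC /= coefC; case: ifP => _; last by rewrite size_poly0.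
  rewrite /chi dhomY; case: eqP => _; first by rewrite size_polyX.
  exact: size_polyC_leq1.
have := mac_grading G D_gt0 Fg Pb Pz Py (size (theta macR)).-1.
by rewrite -/macR [F _]/= coef_map lead_coefE.
Qed.

Definition lam (v : 'I_m -> K) : L' := deform D G (fun i j => red (a i j)) (emb \o v) 0 ord_max.

Hypothesis lam_inj : forall u v, lam u = lam v -> u =1 v.

(** Since G(v) = 0, z drops out of each Y_i at x = v. Then E(Y(v), T(v), z) = 0 is an identity in
    the free variable z, and its leading coefficient vanishes. *)
Lemma lead_theta_zero E v : gen_eval D G a E = 0 ->
  (forall k, (map_mpoly (intmul 1) (G k)).@[v] = 0) ->
  dhom red (deform D G (fun i j => red (a i j)) (emb \o v) 0) 0 (lead_coef (theta E)) = 0.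
Proof.
move=> evE Gv; set ev0 := dhom _ _ _.
pose Ev : {rmorphism {mpoly L[m.+1]} -> {poly L'}} :=
  mmap (polyC \o red) (on_cons 'X (fun j => (emb (v j))%:P)).
have EvC c : Ev c%:MP = (red c)%:P by rewrite /Ev [LHS]/= mmapC.
have Evx j : Ev (@genx q L j) = (emb (v j))%:P by rewrite /Ev [LHS]/= mmapXU on_consS.
have Evz : Ev (@genz q L) = 'X by rewrite /Ev [LHS]/= mmapXU on_cons0.
have Gv' k : int_eval (fun j => (emb (v j))%:P) (G k) = 0.
  rewrite -(@int_eval_ext _ _ (polyC \o (emb \o v))) // -(int_eval_hom polyC) -(int_eval_hom emb).
  suff -> : int_eval v (G k) = 0 by rewrite !rmorph0.
  rewrite -[RHS](Gv k); apply: (mpoly_hom_ext (f := int_eval v)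
    (g := meval v \o map_mpoly (intmul 1))) => [c|i].
    by rewrite [RHS]/= map_mpolyC mevalC /= /int_eval mmapC.
  by rewrite [RHS]/= map_mpolyX mevalXU /= /int_eval mmapXU.
have Gv0 k : int_eval (emb \o v) (G k) = 0.
  apply/eqP; rewrite -(polyC_eq0 (int_eval (emb \o v) (G k))); apply/eqP.
  by rewrite (int_eval_hom polyC); exact: Gv'.
have eqE : map_poly ev0 (theta E) = Ev (gen_eval D G a E).
  apply: (deform_ring_ext (f := map_poly ev0 \o @theta m L) (g := Ev \o gen_eval D G a)) => [c|i|].
  - by rewrite [LHS]/= /theta dhomC /= map_polyC /= /ev0 dhomC [RHS]/= /gen_eval dhomC EvC.
  - rewrite [LHS]/= /theta dhomY map_polyC /= /ev0 dhomY [RHS]/= /gen_eval dhomY.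
    rewrite /genY (deform_hom D G Ev) (deform_hom D G polyC).
    transitivity (deform D G (fun i j => (red (a i j))%:P) (fun j => (emb (v j))%:P) 0 i).
      by apply: deform_ext => [i' j|j].
    transitivity (deform D G (fun i j => (red (a i j))%:P) (fun j => (emb (v j))%:P) 'X i); last first.
      by rewrite Evz; apply: deform_ext => [i' j|j] /=; rewrite ?EvC ?Evx.
    rewrite /deform; congr (_ + _); case: unlift => [k|] //.
    by rewrite Gv' !mulr0.
  - by rewrite [LHS]/= /theta dhomz map_polyX [RHS]/= /gen_eval dhomz Evz.
have := congr1 (fun p : {poly L'} => p`_(size (theta E)).-1) eqE.
by rewrite evE coef_map (rmorph0 Ev) coef0.
Qed.

Lemma count_zeros E e e1 r (vs : seq (m.-tuple K)) :
  gen_eval D G a E = 0 -> lead_coef (theta E) = e -> kappa e = e ->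
  r = e * e1 -> (size (chi r) <= (D ^ m).+1)%N -> redW r != 0 ->
  uniq vs -> (forall v, v \in vs -> forall k, (map_mpoly (intmul 1) (G k)).@[tnth v] = 0) ->
  (size vs <= D ^ m)%N.
Proof.
move=> evE eE ke rE szr r0 vs_uniq Gvs.
have chi_max w : (chi w).[dY L' ord_max] = redW w.
  apply: (deform_ring_ext (f := horner_eval (dY L' ord_max) \o chi) (g := redW)) => [c|i|].
  - by rewrite [LHS]/= /chi dhomC /horner_eval hornerC [RHS]/= /redW dhomC.
  - rewrite [LHS]/= /chi dhomY /horner_eval [RHS]/= /redW dhomY.
    by case: eqP => [->|_]; rewrite ?hornerX ?hornerC.
  - by rewrite [LHS]/= /chi dhomz /horner_eval hornerC [RHS]/= /redW dhomz.
have chir0 : chi r != 0.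
  by apply: contraNneq r0 => r0; rewrite -chi_max r0 horner0.
have chirE : chi r = chi e * chi e1 by rewrite rE (rmorphM chi).
have [chie0 chie10] : chi e != 0 /\ chi e1 != 0.
  by move: chir0; rewrite chirE mulf_eq0 negb_or => /andP.
have size_e : (size (chi e) <= (D ^ m).+1)%N.
  by apply: leq_trans szr; rewrite chirE; apply: size_factor_leq.
pose pt (v : m.-tuple K) : W' := dC m (lam (tnth v)).
have chi_root v : v \in vs -> root (chi e) (pt v).
  move=> v_in; apply/rootP.
  have := lead_theta_zero evE (Gvs v v_in); rewrite eE => ev0.
  (* As [kappa e = e], the value of [e] at all of Y(v), T(v) is the value of [chi e] at T(v)
     alone. *)
  transitivity (dC m (dhom red (deform D G (fun i j => red (a i j)) (emb \o tnth v) 0) 0 (kappa e))).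
    rewrite -{1}ke; apply: (deform_ring_ext (f := horner_eval (pt v) \o chi \o @kappa q L)
      (g := @dC m L' \o dhom red (deform D G (fun i j => red (a i j)) (emb \o tnth v) 0) 0 \o @kappa q L)) => [c|i|].
    - by rewrite [LHS]/= [RHS]/= /kappa !dhomC /chi dhomC /horner_eval hornerC.
    - rewrite [LHS]/= [RHS]/= /kappa !dhomY; case: eqP => [->|_].
        by rewrite /chi !dhomY eqxx /horner_eval hornerX.
      by rewrite !rmorph0.
    - by rewrite [LHS]/= [RHS]/= /kappa !dhomz !rmorph0.
  by rewrite ke ev0 rmorph0.
have pt_inj : injective pt.
  move=> u v /polyC_inj /(can_inj (@mpolyCK _ _)) /lam_inj uv.
  by apply: eq_from_tnth.
have := max_poly_roots chie0 (rs := map pt vs); rewrite size_map map_inj_uniq // vs_uniq.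
have -> : all (root (chi e)) (map pt vs) by apply/allP => _ /mapP [v v_in ->]; apply: chi_root.
by move=> /(_ isT isT) lt_e; rewrite -ltnS; apply: leq_trans lt_e size_e.
Qed.

End Counting.

(** * Coefficients of the determinant *)

Definition is_submonoid (A : comNzRingType) (M : A -> Prop) :=
  M 1 /\ forall x y, M x -> M y -> M (x * y).

(* For [M] the monic monomials, [signed_sum M n x] says that [x] has integer
   coefficients with absolute values adding up to at most [n]. *)
Definition signed_sum (A : comNzRingType) (M : A -> Prop) (n : nat) (x : A) :=
  exists s : seq A, [/\ (size s <= n)%N, forall y, y \in s -> M y \/ M (- y) &
                        x = \sum_(y <- s) y].

Lemma signed_sum1 (A : comNzRingType) (M : A -> Prop) x : M x -> signed_sum M 1 x.
Proof.
by move=> Mx; exists [:: x]; split; rewrite ?big_seq1 // => y; rewrite inE => /eqP ->; left.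
Qed.

Lemma signed_sum_norm_bound (A A' : comNzRingType) (F : {rmorphism A -> A'}) M :
  is_submonoid M -> norm_bound (fun n a => signed_sum M n (F a)).
Proof.
move=> [M1 MM]; split.
- by exists [::]; rewrite rmorph0 big_nil.
- by rewrite rmorph1; apply: signed_sum1.
- move=> n k a b [s [sn sM sE]] [t [tk tM tE]]; exists (s ++ t); split.
  + by rewrite size_cat leq_add.
  + by move=> y; rewrite mem_cat => /orP []; [apply: sM | apply: tM].
  + by rewrite rmorphD big_cat sE tE.
- move=> n a [s [sn sM sE]]; exists (map -%R s); split; first by rewrite size_map.
  + by move=> _ /mapP [y ys ->]; rewrite opprK; case: (sM y ys); [right|left].
  + by rewrite rmorphN sE big_map sumrN.
- move=> n k a b [s [sn sM sE]] [t [tk tM tE]]; exists [seq x * y | x <- s, y <- t]; split.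
  + by rewrite size_allpairs leq_mul.
  + move=> _ /allpairsP [[x y] /= [xs yt ->]].
    case: (sM x xs) => Mx; case: (tM y yt) => My; [left|right|right|left].
    * exact: MM.
    * by rewrite -mulrN; apply: MM.
    * by rewrite -mulNr; apply: MM.
    * by rewrite -mulrNN; apply: MM.
  + rewrite rmorphM sE tE big_allpairs_dep big_distrl; apply: eq_bigr => x _.
    by rewrite big_distrr.
- by move=> n k a nk [s [sn sM sE]]; exists s; split=> //; apply: leq_trans nk.
Qed.

Lemma signed_sum_coef (A : comNzRingType) (M : A -> Prop) (f : A -> int) n x :
  {morph f : y z / y + z} -> (forall y, M y -> (`|f y| <= 1)%N) ->
  signed_sum M n x -> (`|f x| <= n)%N.
Proof.
move=> fD fM [s [sn sM ->]]; apply: leq_trans sn.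
have f0 : f 0 = 0 by apply: (addrI (f 0)); rewrite -fD !addr0.
have fN y : f (- y) = - f y by apply: (addrI (f y)); rewrite -fD !subrr.
elim: s sM => [|y s IHs] sM; first by rewrite big_nil f0.
rewrite big_cons fD -[size _]add1n.
apply: (@leq_trans (`|f y| + `|f (\sum_(j <- s) j)%R|)%N).
  by rewrite -lez_nat PoszD !abszE ler_normD.
apply: leq_add; last by apply: IHs => z zs; apply: sM; rewrite inE zs orbT.
have [/fM //|/fM] : M y \/ M (- y) by apply: sM; rewrite inE eqxx.
by rewrite fN abszN.
Qed.

Definition poly_monomial (A : comNzRingType) (M : A -> Prop) (x : {poly A}) :=
  exists c k, M c /\ x = c%:P * 'X^k.

Definition mpoly_monomial n (A : comNzRingType) (M : A -> Prop) (x : {mpoly A[n]}) :=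
  exists c u, M c /\ x = c%:MP * 'X_[u].

Lemma poly_monomialP (A : comNzRingType) (M : A -> Prop) :
  is_submonoid M -> is_submonoid (poly_monomial M).
Proof.
move=> [M1 MM]; split; first by exists 1, 0%N; rewrite mul1r.
move=> _ _ [c [k [Mc ->]]] [d [l [Md ->]]]; exists (c * d), (k + l)%N; split; first exact: MM.
by rewrite mulrACA -polyCM -exprD.
Qed.

Lemma mpoly_monomialP n (A : comNzRingType) (M : A -> Prop) :
  is_submonoid M -> is_submonoid (@mpoly_monomial n A M).
Proof.
move=> [M1 MM]; split; first by exists 1, 0%MM; rewrite mpolyX0 mulr1.
move=> _ _ [c [k [Mc ->]]] [d [l [Md ->]]]; exists (c * d), (k + l)%MM; split; first exact: MM.
by rewrite mulrACA -mpolyCM -mpolyXD.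
Qed.

Lemma poly_monomial_coef (A : comNzRingType) (M : A -> Prop) (y : {poly A}) i :
  poly_monomial M y -> M y`_i \/ y`_i = 0.
Proof.
move=> [c [k [Mc ->]]]; rewrite coefCM coefXn.
by case: eqP => _; [left; rewrite mulr1 | right; rewrite mulr0].
Qed.

Lemma mpoly_monomial_coef n (A : comNzRingType) (M : A -> Prop) (y : {mpoly A[n]}) u :
  mpoly_monomial M y -> M y@_u \/ y@_u = 0.
Proof.
move=> [c [k [Mc ->]]]; rewrite mcoeffCM mcoeffX.
by case: eqP => _; [left; rewrite mulr1 | right; rewrite mulr0].
Qed.

(** The four layers are the powers of z, the powers of Y_0, the monomials in the remaining
    variables, and those in the parameters a_ij. *)
Lemma nested_coef_bound (A : comNzRingType) (n1 n2 : nat) (M : A -> Prop) (f : A -> int)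
    (n : nat) (w : {poly {poly {mpoly {mpoly A[n1]}[n2]}}}) d i u v :
  {morph f : y z / y + z} -> (forall y, M y -> (`|f y| <= 1)%N) ->
  signed_sum (poly_monomial (poly_monomial (@mpoly_monomial n2 _ (@mpoly_monomial n1 A M)))) n w ->
  (`|f ((((w`_d)`_i)@_u)@_v)%R| <= n)%N.
Proof.
move=> fD fM; have f0 : f 0 = 0 by apply: (addrI (f 0)); rewrite -fD !addr0.
apply: (@signed_sum_coef _ _ (fun w : {poly {poly {mpoly {mpoly A[n1]}[n2]}}} =>
  f (w`_d`_i@_u@_v))) => [y z|y My].
  by rewrite !coefD !mcoeffD fD.
have [My1|->] := poly_monomial_coef d My; last by rewrite coef0 !mcoeff0 f0.
have [My2|->] := poly_monomial_coef i My1; last by rewrite !mcoeff0 f0.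
have [My3|->] := mpoly_monomial_coef u My2; last by rewrite !mcoeff0 f0.
have [My4|->] := mpoly_monomial_coef v My3; last by rewrite f0.
exact: fM.
Qed.

Definition int_monomial (x : int) := x = 1.

Lemma int_monomialP : is_submonoid int_monomial.
Proof. by split=> // x y -> ->. Qed.

Section ConcreteParams.
Variables (m n : nat).
Local Notation N := #|{: 'I_m * 'I_n}|.

Definition cpar (R : nzRingType) (i : 'I_m) (j : 'I_n) : {mpoly R[N]} := 'X_(enum_rank (i, j)).

Lemma cpar_free : free_params (cpar int).
Proof.
split=> [A b|A h h' hh' x].
  exists (mmap (intmul 1) (fun k => b (enum_val k).1 (enum_val k).2)) => i j.
  by rewrite /= /cpar mmapXU enum_rankK.
apply: (mpoly_hom_ext (f := h) (g := h')) => [c|k].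
  exact: (int_hom_ext (h \o @mpolyC N int) (h' \o @mpolyC N int) c).
have := hh' (enum_val k).1 (enum_val k).2; rewrite /cpar.
by rewrite -surjective_pairing enum_valK.
Qed.

End ConcreteParams.

Lemma theta_neq0 n (L : comNzRingType) (w : deform_ring n L) : w != 0 -> theta w != 0.
Proof.
move=> w0; suff wE : (theta w).[dz n L] = w by apply: contraNneq w0 => t0; rewrite -wE t0 horner0.
apply: (deform_ring_ext (f := horner_eval (dz n L) \o @theta n L) (g := idfun)) => [c|i|].
- by rewrite [LHS]/= /theta dhomC /horner_eval hornerC.
- by rewrite [LHS]/= /theta dhomY /horner_eval hornerC.
- by rewrite [LHS]/= /theta dhomz /horner_eval hornerX.
Qed.

Lemma redW_coef q (L L' : idomainType) (red : {rmorphism L -> L'}) (w : deform_ring q.+1 L) i u :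
  ((redW red w : {poly {mpoly L'[q.+2]}})`_i)@_u = red (((w : {poly {mpoly L[q.+2]}})`_i)@_u).
Proof.
suff -> : redW red w = map_poly (map_mpoly red) w :> {poly {mpoly L'[q.+2]}}.
  by rewrite coef_map mcoeff_map_mpoly.
rewrite /redW /dhom /horner_eval /=.
rewrite (_ : map_poly _ _ = map_poly polyC (map_poly (map_mpoly red) w)).
  by rewrite /dY on_cons0; apply: comp_polyXr.
rewrite -map_poly_comp; apply: eq_map_poly => p; rewrite [RHS]/=.
set f := mmap _ _; apply: (mpoly_hom_ext (f := f) (g := polyC \o map_mpoly red) _ _ p) => [c|k].
  by rewrite [LHS]/= /f mmapC [RHS]/= map_mpolyC.
rewrite [LHS]/= /f mmapXU [RHS]/= map_mpolyX; case: (unliftP ord0 k) => [j|] ->.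
  by rewrite on_consS /dY on_consS.
by rewrite on_cons0.
Qed.

Section ThetaMonomials.
Variables (m : nat) (L : comNzRingType) (M : L -> Prop).
Hypothesis MP : is_submonoid M.

Definition theta_monomial : {poly (deform_ring m L)} -> Prop :=
  @poly_monomial (deform_ring m L) (poly_monomial (@mpoly_monomial m.+1 L M)).

Lemma theta_monomialP : is_submonoid theta_monomial.
Proof. by do 2![apply: poly_monomialP]; apply: mpoly_monomialP. Qed.

Lemma theta_monomial_const w :
  poly_monomial (@mpoly_monomial m.+1 L M) w -> theta_monomial w%:P.
Proof. by move=> Mw; exists w, 0%N; rewrite mulr1. Qed.

Lemma theta_monomialC c : M c -> theta_monomial (theta (dC m c)).
Proof.
rewrite /theta dhomC => Mc; apply: theta_monomial_const; exists c%:MP, 0%N.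
by rewrite mulr1; split=> //; exists c, 0%MM; rewrite mpolyX0 mulr1.
Qed.

Lemma theta_monomialY i : theta_monomial (theta (dY L i)).
Proof.
have [M1 _] := MP; rewrite /theta dhomY; apply: theta_monomial_const.
case: (unliftP ord0 i) => [k|] ->; rewrite /dY; last first.
  rewrite on_cons0; exists 1, 1%N; rewrite mul1r; split=> //.
  by exists 1, 0%MM; rewrite mpolyX0 mulr1.
rewrite on_consS; exists 'X_(lift ord0 k), 0%N; rewrite mulr1; split=> //.
by exists 1, U_(lift ord0 k)%MM; rewrite mul1r.
Qed.

Lemma theta_monomialz : theta_monomial (theta (dz m L)).
Proof.
have [M1 _] := MP; rewrite /theta dhomz; exists 1, 1%N; rewrite mul1r; split=> //.
exists 1, 0%N; rewrite mulr1; split=> //.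
by exists 1, 0%MM; rewrite mpolyX0 mulr1.
Qed.

End ThetaMonomials.

Lemma macR_signed_sum q D H (G : 'I_q.+1 -> {mpoly int[q.+1]}) (L : idomainType) (M : L -> Prop) a :
  (0 < D)%N -> (forall k v, `|(G k)@_v| <= H)%N -> is_submonoid M -> (forall i j, M (a i j)) ->
  signed_sum (@theta_monomial q.+1 L M)
    ((#|{: 'X_{1..q.+1 < mac_bound q D}}|)`! * (H + q.+1 + 2) ^ #|{: 'X_{1..q.+1 < mac_bound q D}}|)
    (theta (macR D G a)).
Proof.
move=> D_gt0 G_height MP aM.

have Qn := @signed_sum_norm_bound (deform_ring q.+1 L) _ (@theta q.+1 L) _ (theta_monomialP q.+1 MP).
have Qb k j : signed_sum (@theta_monomial q.+1 L M) 1 (theta (dC q.+1 (a k j))).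
  by apply: signed_sum1; apply: theta_monomialC.
have Qz : signed_sum (@theta_monomial q.+1 L M) 1 (theta (dz q.+1 L)).
  by apply: signed_sum1; apply: theta_monomialz.
have Qy k : signed_sum (@theta_monomial q.+1 L M) 1 (theta (dY L k)).
  by apply: signed_sum1; apply: theta_monomialY.
have QR := mac_norm_bound D_gt0 Qn Qb Qz Qy G_height.
exact: QR.
Qed.

Section Core.
Variables (q D H : nat).
Local Notation m := q.+1.
Variable G : 'I_m -> {mpoly int[m]}.
Hypotheses (D_gt0 : (0 < D)%N) (G_deg : forall k, (msize (G k) <= D.+1)%N).
Hypothesis G_height : forall k v, (`|(G k)@_v| <= H)%N.
Hypothesis coordP : forall j, exists (psi : {poly int}) (g : 'I_m -> {mpoly int[m]}),
    psi != 0 /\ poly_at 'X_j psi = \sum_i g i * G i.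

Local Notation L := {mpoly int[#|{: 'I_m.+1 * 'I_m}|]}.
Local Notation a := (@cpar m.+1 m int).
Local Notation R := (macR D G a).
Local Notation card_mon := #|{: 'X_{1..m < mac_bound q D}}|.

Lemma macR_neq0 : R != 0.
Proof.
pose l : {rmorphism L -> int} := mmap (intmul 1) (fun=> 0).
apply: (mac_neq0 G D_gt0 (h := dhom l (fun i => (i == ord_max)%:R) 0)) => [i j||i].
- by rewrite [LHS]/= dhomC /l /cpar [LHS]mmapXU.
- by rewrite [LHS]/= dhomz.
- by rewrite [LHS]/= dhomY.
Qed.

Lemma macR_eval : gen_eval D G a R = 0.
Proof.
apply: (mac_vanish D_gt0 G_deg (h := gen_eval D G a) (x := @genx q L)) => i.
have evz : gen_eval D G a (dz m L) = @genz q L by rewrite /gen_eval dhomz.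
have evC c : gen_eval D G a (dC m c) = c%:MP by rewrite /gen_eval dhomC.
rewrite [LHS]/= {1}/gen_eval dhomY [X in _ = deform _ _ _ _ X _]/= evz /genY.
by apply: deform_ext => // i' j; rewrite [RHS]/= evC.
Qed.

Lemma macR_bound d i u v :
  (`|(((((theta R)`_d : deform_ring m L) : {poly {mpoly L[m.+1]}})`_i)@_u)@_v|
     <= (card_mon)`! * (H + m + 2) ^ card_mon)%N.
Proof.
apply: (nested_coef_bound (f := idfun) (M := int_monomial)) => // [y -> //|].
apply: macR_signed_sum => //; first by apply: mpoly_monomialP; apply: int_monomialP.
by move=> k j; exists 1, U_(enum_rank (k, j))%MM; rewrite mul1r.
Qed.

End Core.

Lemma mpoly_coef_neq0 n (A : nzRingType) (p : {mpoly A[n]}) : p != 0 -> exists u, p@_u != 0.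
Proof.
move=> p0; apply: contrapT => no; case/eqP: p0; apply/mpolyP => u; rewrite mcoeff0.
by apply: contrapT => pu; apply: no; exists u; apply/eqP.
Qed.

Lemma nested_coef_neq0 n1 n2 (A : nzRingType) (w : {poly {mpoly {mpoly A[n1]}[n2]}}) :
  w != 0 -> exists i u v, ((w`_i)@_u)@_v != 0.
Proof.
rewrite -lead_coef_eq0 lead_coefE => /mpoly_coef_neq0 [u /mpoly_coef_neq0 [v wv]].
by exists (size w).-1, u, v.
Qed.

Lemma dvdn_char_int (K : nzRingType) p (c : int) : p \in [pchar K] -> c%:~R = 0 :> K -> (p %| `|c|)%N.
Proof.
move=> pK c0; rewrite (dvdn_pcharf pK); apply/eqP.
by case: c c0 => n //; rewrite NegzE rmorphN => /eqP; rewrite oppr_eq0 => /eqP.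
Qed.

(** v_j is the coefficient of the parameter a_mj in T(v). *)
Lemma lam_cpar_inj q D (G : 'I_q.+1 -> {mpoly int[q.+1]}) (K : idomainType) (u v : 'I_q.+1 -> K) :
  let N := #|{: 'I_q.+2 * 'I_q.+1}| in
  let l := lam D G (cpar int) (map_mpoly (intmul 1) : {rmorphism {mpoly int[N]} -> {mpoly K[N]}})
    (@mpolyC N K) in
  l u = l v -> u =1 v.
Proof.
move=> N l uv j.
have lamE w : (l w)@_(U_(enum_rank (ord_max, j))) = w j.
  rewrite /l /lam /deform unlift_none mcoeffD mcoeffC mnm1_eq0 mulr0 add0r raddf_sum /=.
  rewrite (bigD1 j) //= big1 ?addr0 => [|i ij].
    by rewrite /cpar map_mpolyX mulrC mcoeffCM mcoeffX eqxx mulr1.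
  rewrite /cpar map_mpolyX mulrC mcoeffCM mcoeffX eq_mnm1 (inj_eq enum_rank_inj) xpair_eqE eqxx /=.
  by rewrite (negbTE ij) mulr0.
by rewrite -lamE uv lamE.
Qed.

Section Core.
Variables (q D H : nat).
Local Notation m := q.+1.
Variable G : 'I_m -> {mpoly int[m]}.
Hypotheses (D_gt0 : (0 < D)%N) (G_deg : forall k, (msize (G k) <= D.+1)%N).
Hypothesis G_height : forall k v, (`|(G k)@_v| <= H)%N.
Hypothesis coordP : forall j, exists (psi : {poly int}) (g : 'I_m -> {mpoly int[m]}),
    psi != 0 /\ poly_at 'X_j psi = \sum_i g i * G i.

Local Notation card_mon := #|{: 'X_{1..m < mac_bound q D}}|.

Lemma zeros_mod_p : exists A : nat,
  [/\ (0 < A)%N, (A <= (card_mon)`! * (H + m + 2) ^ card_mon)%N &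
    forall p (K : idomainType) (vs : seq (m.-tuple K)), ~~ (p %| A)%N -> p \in [pchar K] ->
    uniq vs -> (forall v, v \in vs -> forall k, (map_mpoly (intmul 1) (G k)).@[tnth v] = 0) ->
    (size vs <= D ^ m)%N].
Proof.
have R0 := macR_neq0 G D_gt0.
have [E [e1 [evE rE kE]]] := certificate (cpar_free _ _) D_gt0 (factorial_mpoly factorial_int)
  coordP R0 (macR_eval D_gt0 G_deg).
have r0 : lead_coef (theta (macR D G (cpar int))) != 0 by rewrite lead_coef_eq0 theta_neq0.
have [i [u [v c0]]] := nested_coef_neq0 r0.
have cB := macR_bound D_gt0 G_height (size (theta (macR D G (cpar int)))).-1 i u v.
exists `|((lead_coef (theta (macR D G (cpar int))) : {poly {mpoly _[_]}})`_i)@_u@_v|%N.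
split; [by rewrite absz_gt0; exact: c0 | by rewrite lead_coefE; exact: cB |].
move=> p K vs pA pK vs_uniq Gvs.
pose red : {rmorphism {mpoly int[#|{: 'I_q.+2 * 'I_q.+1}|]} -> {mpoly K[#|{: 'I_q.+2 * 'I_q.+1}|]}} :=
  map_mpoly (intmul 1).
apply: (count_zeros (lam_cpar_inj (D := D) (G := G) (K := K)) evE (erefl _) kE rE _ _ vs_uniq Gvs).
  exact: (macR_size G (cpar int) red D_gt0).
apply: contraNneq pA => redr0; apply: (dvdn_char_int pK).
have := redW_coef red (lead_coef (theta (macR D G (cpar int)))) i u.
rewrite redr0 coef0 mcoeff0 => /(congr1 (mcoeff v)).
by rewrite mcoeff0 /red [RHS]mcoeff_map_mpoly => ->.
Qed.

End Core.

(** * Iterates and heights *)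

Lemma grading_int (A : comNzRingType) (P : nat -> A -> Prop) (c : int) : grading P -> P 0%N c%:~R.
Proof.
move=> [P0 P1 PD PN PM PS].
have Pnat (k : nat) : P 0%N k%:R.
  by elim: k => // k IHk; rewrite -addn1 natrD; apply: (PD).
by case: c => k; [apply: (Pnat) | rewrite NegzE rmorphN; apply: (PN); apply: (Pnat)].
Qed.

Lemma grading_exp (A : comNzRingType) (P : nat -> A -> Prop) e a k :
  grading P -> P e a -> P (k * e)%N (a ^+ k).
Proof. by move=> [P0 P1 PD PN PM PS] Pa; elim: k => // k IHk; rewrite exprS mulSn; apply: (PM). Qed.

Lemma grading_eval (A : comNzRingType) (P : nat -> A -> Prop) n (x : 'I_n -> A) e d p :
  grading P -> (forall j, P e (x j)) -> (msize p <= d.+1)%N -> P (d * e)%N (int_eval x p).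
Proof.
move=> Pg Px p_deg; have [P0 P1 PD PN PM PS] := Pg; rewrite /int_eval /mmap big_seq.
apply: (big_ind (P (d * e)%N)) => [||u up]; [exact: P0 | exact: PD |].
apply: (PS (0 + mdeg u * e)%N).
  by rewrite add0n leq_mul2r -ltnS (leq_trans (msize_mdeg_lt up)) ?orbT.
apply: (PM); first exact: grading_int.
rewrite /mmap1 mdegE big_distrl /=.
by apply: (big_ind2 (fun n a => P n a)) => // [k a l b|i _]; [apply: (PM) | apply: grading_exp].
Qed.

Lemma norm_bound_exp (A : comNzRingType) (Q : nat -> A -> Prop) B a k :
  norm_bound Q -> Q B a -> Q (B ^ k)%N (a ^+ k).
Proof. by move=> [Q0 Q1 QD QN QM QS] Qa; elim: k => // k IHk; rewrite exprS expnS; apply: (QM). Qed.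

Lemma norm_bound_eval (A : comNzRingType) (Q : nat -> A -> Prop) n (x : 'I_n -> A) B d H p :
  norm_bound Q -> (0 < B)%N -> (forall j, Q B (x j)) ->
  (forall u, `|p@_u| <= H)%N -> (msize p <= d.+1)%N ->
  Q (d.+1 ^ n * H * B ^ d)%N (int_eval x p).
Proof.
move=> Qn B0 Qx pH p_deg; have [Q0 Q1 QD QN QM QS] := Qn.
rewrite {1}(mpolywE p_deg) (raddf_sum (int_eval x)).
apply: (QS (#|{: 'X_{1..n < d.+1}}| * (H * B ^ d))%N).
  by rewrite -mulnA leq_mul2r card_bmultinom orbT.
apply: norm_bound_sum => // u; rewrite /= -mul_mpolyC rmorphM /= /int_eval mmapC.
apply: (QM).
  by apply: (QS `|p@_u|%N); [apply: pH | apply: norm_bound_int].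
rewrite mmapX; apply: (QS (B ^ mdeg u)%N).
  by rewrite leq_pexp2l // -ltnS bmdeg.
rewrite /mmap1 mdegE expn_sum.
by apply: (big_ind2 (fun n a => Q n a)) => // [k a l b|i _]; [apply: (QM) | apply: norm_bound_exp].
Qed.

Lemma comp_mpoly_int m n (p : {mpoly int[m]}) (x : m.-tuple {mpoly int[n]}) :
  p \mPo x = int_eval (tnth x) p.
Proof.
rewrite /comp_mpoly /int_eval /mmap; apply: eq_bigr => u _; congr (_ * _).
exact: (int_hom_ext (@mpolyC n int) (intmul 1)).
Qed.

Lemma msize_grading m : grading (fun n (p : {mpoly int[m]}) => (msize p <= n.+1)%N).
Proof.
split=> [n||n a b ha hb|n a|n k a b ha hb|n k a nk ha].
- by rewrite msize0.
- by rewrite msize1.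
- by rewrite (leq_trans (msizeD_le _ _)) // geq_max ha.
- by rewrite msizeN.
- apply: leq_trans (msizeM_leq a b) _; move: (msize a) (msize b) ha hb => s t; lia.
- exact: leq_trans ha _.
Qed.

Definition int_mpoly_monomial m := @mpoly_monomial m int int_monomial.

Lemma l1_norm_bound m : norm_bound (signed_sum (@int_mpoly_monomial m)).
Proof.
exact: (signed_sum_norm_bound idfun (mpoly_monomialP m int_monomialP)).
Qed.

Lemma l1_coef m n (p : {mpoly int[m]}) u : signed_sum (@int_mpoly_monomial m) n p -> (`|p@_u| <= n)%N.
Proof.
apply: (signed_sum_coef (f := fun p : {mpoly int[m]} => p@_u)) => [y z|y My]; first exact: mcoeffD.
by have [->|->] := mpoly_monomial_coef u My.
Qed.

Lemma l1_var m (i : 'I_m) : signed_sum (@int_mpoly_monomial m) 1 'X_i.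
Proof. by apply: signed_sum1; exists 1, U_(i)%MM; rewrite mul1r. Qed.

Section Iterates.
Variables (m d H : nat) (F : poly_system m int).
Hypotheses (d_gt1 : (1 < d)%N) (H_gt0 : (0 < H)%N) (F_deg : degree_le F d).
Hypothesis F_height : forall i u, (`|(tnth F i)@_u| <= H)%N.

Lemma iter_sys_msize n i : (msize (tnth (iter_sys F n) i) <= (d ^ n).+1)%N.
Proof.
elim: n i => [|n IHn] i; first by rewrite tnth_mktuple msizeX mdeg1.
rewrite tnth_mktuple comp_mpoly_int expnS.
exact: (grading_eval (msize_grading m) IHn (F_deg i)).
Qed.

(** Each composition raises the bound to the power d and costs one more factor (d+1)^m H, so the
    exponent is 1 + d + ... + d^(n-1). Its being strictly below d^n leaves a spare factor. *)
Lemma iter_sys_norm n : exists2 e, (e < d ^ n)%N &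
  forall i, signed_sum (@int_mpoly_monomial m) ((d.+1 ^ m * H) ^ e) (tnth (iter_sys F n) i).
Proof.
elim: n => [|n [e e_lt IHn]].
  by exists 0%N => // i; rewrite tnth_mktuple; apply: l1_var.
exists (e * d).+1.
  have : (e.+1 * d <= d ^ n * d)%N by rewrite leq_mul2r e_lt orbT.
  by rewrite -expnSr; lia.
move=> i; rewrite tnth_mktuple comp_mpoly_int expnS expnM.
apply: (norm_bound_eval (l1_norm_bound m) _ IHn (F_height i) (F_deg i)).
by rewrite expn_gt0 muln_gt0 expn_gt0 H_gt0.
Qed.

Lemma iter_sys_height n i u :
  (`|(tnth (iter_sys F n) i - 'X_i)@_u| <= (d.+1 ^ m * H) ^ d ^ n)%N.
Proof.
have [e e_lt he] := iter_sys_norm n; have [_ _ QD QN _ QS] := l1_norm_bound m.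
apply: l1_coef; apply: (QS ((d.+1 ^ m * H) ^ e + 1)%N); last first.
  by apply: (QD); [apply: he | apply: (QN); apply: l1_var].
have B_gt1 : (1 < d.+1 ^ m * H)%N.
  have m_gt0 : (0 < m)%N by case: (i) => j; case: (m).
  apply: (@leq_trans (d.+1 ^ 1 * 1)%N); first by rewrite expn1 muln1 ltnS ltnW.
  by rewrite leq_mul // leq_pexp2l.
(* The spare factor, at least 2, absorbs the 1 contributed by 'X_i. *)
apply: (@leq_trans ((d.+1 ^ m * H) ^ e.+1)%N); last by rewrite leq_pexp2l // ltnW.
have : (0 < (d.+1 ^ m * H) ^ e)%N by rewrite expn_gt0 ltnW.
by rewrite expnS; nia.
Qed.

End Iterates.

(** * Periodic points and the final estimate *)

Local Open Scope card_scope.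

(** A longest list of distinct elements exhausts the set, since any further element would lengthen
    it. *)
Lemma card_le_seq (T : choiceType) (X : set T) n :
  (forall s, uniq s -> (forall x, x \in s -> X x) -> (size s <= n)%N) -> X #<= `I_n.
Proof.
move=> Xn.
pose P k := `[< exists s : seq T, [/\ uniq s, forall x, x \in s -> X x & size s = k] >].
have P0 : exists k, P k by exists 0%N; apply/asboolP; exists [::].
have Pn k : P k -> (k <= n)%N by move=> /asboolP [s [us sX <-]]; apply: Xn.
case: (ex_maxnP P0 Pn) => k /asboolP [s [us sX sk]] k_max.
have XE : X = [set` [fset x in s]%fset]%classic.
  rewrite predeqE => x; split=> [Xx|] /=; last by rewrite !inE => /sX.
  rewrite !inE; apply: contrapT => /negP xs.
  have /k_max : P k.+1; last by rewrite ltnn.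
  apply/asboolP; exists (x :: s); split; [by rewrite /= xs | | by rewrite /= sk].
  by move=> y; rewrite inE => /predU1P [->|/sX].
have : X #<= `I_k.
  rewrite {1}XE (card_le_eql (B := `I_k)) ?card_lexx //; apply/card_eq_fsetP.
  by rewrite card_fseq undup_id.
by move=> /card_le_trans; apply; rewrite card_le_II; apply: Pn; apply/asboolP; exists s.
Qed.

Lemma iter_map_sys (R S : comNzRingType) (f : {rmorphism R -> S}) m (F : poly_system m R) n i :
  tnth (iter_sys (map_sys f F) n) i = map_mpoly f (tnth (iter_sys F n) i).
Proof.
elim: n i => [|n IHn] i; first by rewrite !tnth_mktuple map_mpolyX.
rewrite !tnth_mktuple.
apply: esym; apply: (mpoly_hom_ext (f := map_mpoly f \o comp_mpoly (iter_sys F n))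
  (g := comp_mpoly (iter_sys (map_sys f F) n) \o map_mpoly f)) => [c|j].
  by rewrite /= comp_mpolyC !map_mpolyC comp_mpolyC.
by rewrite /= map_mpolyX /comp_mpoly !mmapXU IHn.
Qed.

Lemma map_sys_int_comp (S K : comNzRingType) (g : {rmorphism S -> K}) (f : {rmorphism int -> S})
    m (F : poly_system m int) :
  map_sys g (map_sys f F) = map_sys (intmul 1 : {rmorphism int -> K}) F.
Proof.
apply: eq_from_tnth => i; rewrite !tnth_mktuple; apply/mpolyP => u.
by rewrite !mcoeff_map_mpoly; apply: (int_hom_ext (g \o f)).
Qed.

Lemma periodic_pointsP (K : comNzRingType) m (F : poly_system m int) k (w : m.-tuple K) :
  periodic_points (map_sys (intmul 1 : {rmorphism int -> K}) F) k w <->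
  forall i, (map_mpoly (intmul 1) (tnth (iter_sys F k) i - 'X_i)).@[tnth w] = 0.
Proof.
have E i : (map_mpoly (intmul 1) (tnth (iter_sys F k) i - 'X_i)).@[tnth w] =
    (tnth (iter_sys (map_sys (intmul 1 : {rmorphism int -> K}) F) k) i).@[tnth w] - tnth w i.
  by rewrite iter_map_sys rmorphB /= map_mpolyX mevalB mevalXU.
split=> [wP i|wP].
  by rewrite E -[X in _ - tnth X i]wP tnth_mktuple subrr.
by apply: eq_from_tnth => i; rewrite tnth_mktuple; apply/eqP; rewrite -subr_eq0 -E wP.
Qed.

Lemma height_coef_bound (R : realType) (h : R) :
  exists2 H : nat, (0 < H)%N &
    forall m (P : {mpoly int[m]}) u, height R P <= h -> (`|P@_u| <= H)%N.
Proof.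
have h_bd := archi_boundP (expR_ge0 h).
have H_gt0 : (0 < Num.bound (expR h))%N by rewrite -(ltr0n R) (le_lt_trans _ h_bd) ?expR_ge0.
exists (Num.bound (expR h)) => // m P u.
rewrite /height; set M := \max_(_ <- _) _ => hM.
have [uP|uP] := boolP (u \in msupp P); last by rewrite memN_msupp_eq0.
have le_M : (`|P@_u| <= M)%N by apply: (@leq_bigmax_seq _ _ xpredT (fun u => `|P@_u|%N)).
apply: leq_trans le_M _; have [->//|M_gt0] := posnP M.
rewrite ltnW // -(ltr_nat R) (le_lt_trans _ h_bd) //.
by rewrite -[leLHS]lnK ?posrE ?ltr0n // ler_expR.
Qed.

(** N! M^N <= (N M)^N, and the base N M is put below a D-th power: D < 2^D gives N <= (m^m 2^m)^D,
    and B^D + m + 2 <= (m + 3) B^D. *)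
Lemma mac_size_bound q D B : (0 < q)%N -> (1 < D)%N -> (0 < B)%N ->
  ((#|{: 'X_{1..q.+1 < mac_bound q D}}|)`! * (B ^ D + q.+1 + 2) ^ #|{: 'X_{1..q.+1 < mac_bound q D}}|
    <= (q.+1 ^ q.+1 * 2 ^ q.+1 * (q.+1 + 3) * B) ^ (D * (q.+1 * D) ^ q.+1))%N.
Proof.
move=> q_gt0 D_gt1 B_gt0; set N := #|_|; set m := q.+1.
have N_le : (N <= (m * D) ^ m)%N.
  apply: leq_trans (card_bmultinom _ _) _; rewrite leq_exp2r // /mac_bound -/m.
  (* m (D - 1) + 2 <= m D requires m to be at least 2. *)
  have : (2 <= m)%N by rewrite /m ltnS.
  by case: (D) D_gt1 => // D' _ m2; rewrite /= mulnS; lia.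
have fact_le : (N`! <= N ^ N)%N.
  by elim: (N) => // n IHn; rewrite factS expnS leq_mul // (leq_trans IHn) //; case: n {IHn} => // n; rewrite leq_exp2r.
apply: (@leq_trans ((m ^ m * 2 ^ m * (m + 3) * B) ^ (D * N))%N); last first.
  by rewrite leq_pexp2l // ?leq_mul // !muln_gt0 !expn_gt0 B_gt0 addnS.
rewrite expnM.
apply: (@leq_trans ((N * (B ^ D + m + 2)) ^ N)%N); first by rewrite expnMn leq_mul.
have BD : (0 < B ^ D)%N by rewrite expn_gt0 B_gt0.
have le1 : (B ^ D + m + 2 <= (m + 3) * B ^ D)%N by nia.
have le2 : (m + 3 <= (m + 3) ^ D)%N by rewrite -[leqLHS]expn1 leq_pexp2l ?addnS // ltnW.
have le3 : (N <= (m ^ m) ^ D * (2 ^ m) ^ D)%N.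
  apply: leq_trans N_le _; rewrite expnMn leq_mul //.
    by rewrite -[leqLHS]expn1 leq_pexp2l ?expn_gt0 // ltnW.
  by rewrite -expnM mulnC expnM leq_exp2r // ltnW // ltn_expl.
have le4 : (N * (B ^ D + m + 2) <= (m ^ m * 2 ^ m * (m + 3) * B) ^ D)%N.
  rewrite !expnMn -mulnA; apply: leq_mul => //.
  by apply: leq_trans le1 _; rewrite leq_mul.
by case: (N) le4 => // n; rewrite leq_exp2r.
Qed.

(** The exponent is a D^(n+1), and n + 1 <= 3 n + 2. The added 1 keeps the constant positive even if
    ln c = 0. *)
Lemma ln_expn_bound (R : realType) (c a D n : nat) : (0 < c)%N -> (0 < D)%N ->
  ln (c ^ (D * (a * D ^ n)))%:R <= (a%:R * ln c%:R + 1) * (D ^ (3 * n + 2))%:R :> R.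
Proof.
move=> c_gt0 D_gt0; have lnc : 0 <= ln c%:R :> R by rewrite ln_ge0 // ler1n.
rewrite natrX lnXn ?ltr0n // -[_ *+ (D * _)]mulr_natl mulnCA natrM.
apply: (@le_trans _ _ (a%:R * ln c%:R * (D ^ (3 * n + 2))%:R)).
  rewrite -!mulrA ler_wpM2l // mulrC ler_wpM2l // ler_nat -expnS leq_pexp2l //.
  by lia.
by rewrite ler_wpM2r // lerDl.
Qed.

(* The implied constant C is chosen before F and k. *)
Theorem theorem4p3 (R : realType) (d m : nat) (h : R)
    (hd : (2 <= d)%N) (hm : (2 <= m)%N) :
  exists C : R, 0 < C /\
  forall (F : poly_system m int) (k : nat),
    degree_le F d -> height_le F h -> (1 <= k)%N ->
    finite_set (periodic_points (complex_sys R F) k) ->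
  exists A : nat, [/\ (1 <= A)%N,
    ln A%:R <= C * (d ^ (k * (3 * m + 2)))%:R &
    forall p : nat, prime p -> ~~ (p %| A)%N ->
    forall (K : closedFieldType) (iota : {rmorphism 'F_p -> K}),
      is_alg_closure iota ->
      periodic_points (map_sys iota (reduce_sys p F)) k #<= `I_(d ^ (k * m))].
Proof.
have [H H_gt0 height_bound] := height_coef_bound h.
case: m hm => [//|[//|q']] _; set q := q'.+1; set m := q.+1.
pose B := (d.+1 ^ m * H)%N.
have B_gt0 : (0 < B)%N by rewrite muln_gt0 expn_gt0 H_gt0.
have [C1 [C1_gt0 C1E]] : exists C1, (0 < C1)%N /\ C1 = (m ^ m * 2 ^ m * (m + 3) * B)%N.
  eexists; split; last reflexivity.
  by rewrite muln_gt0 B_gt0 andbT muln_gt0 addnS andbT muln_gt0; rewrite !expn_gt0.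
have lnC1 : 0 <= ln C1%:R :> R by rewrite ln_ge0 // ler1n.
exists ((m ^ m)%:R * ln C1%:R + 1); split; first by rewrite ltr_wpDl // mulr_ge0.
move=> F k F_deg F_height k_gt0 /finite_seqP [s sE].
pose D := (d ^ k)%N; pose G (i : 'I_m) := tnth (iter_sys F k) i - 'X_i.
have D_gt1 : (1 < D)%N by rewrite (leq_trans hd) // -[leqLHS]expn1 leq_pexp2l // ltnW.
have G_deg i : (msize (G i) <= D.+1)%N.
  rewrite (leq_trans (msizeD_le _ _)) // geq_max iter_sys_msize // msizeN msizeX mdeg1.
  by rewrite ltnS ltnW.
have G_height i u : (`|(G i)@_u| <= B ^ D)%N.
  by apply: iter_sys_height => // j v; apply: height_bound; apply: F_height.
have coordP j : exists (psi : {poly int}) (g : 'I_m -> {mpoly int[m]}),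
    psi != 0 /\ poly_at 'X_j psi = \sum_i g i * G i.
  apply: (@finite_zeros_coordinate R[i] m G j [seq tnth w j | w <- s]) => w Gw.
  have -> : w j = tnth [tuple w i | i < m] j by rewrite tnth_mktuple.
  apply: map_f; suff : [set` s]%classic [tuple w i | i < m] by [].
  rewrite -sE; apply/periodic_pointsP => i; rewrite -[RHS](Gw i).
  by apply: meval_eq => l; rewrite tnth_mktuple.
have [A [A_gt0 A_le zeros_le]] := zeros_mod_p (ltnW D_gt1) G_deg G_height coordP.
exists A; split=> // [|p p_prime pA K iota _].
  have A_le' := leq_trans A_le (mac_size_bound (ltn0Sn q') D_gt1 B_gt0); rewrite -C1E in A_le'.
  apply: (@le_trans _ _ (ln ((C1 ^ (D * (m * D) ^ m))%:R))).
    by rewrite ler_ln ?posrE ?ltr0n ?expn_gt0 ?C1_gt0 // ler_nat.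
  by rewrite expnMn [(d ^ _)%N]expnM; apply: ln_expn_bound (ltnW D_gt1).
rewrite /reduce_sys map_sys_int_comp expnM.
apply: card_le_seq => vs vs_uniq vsP.
apply: (zeros_le p K vs) => // [|v /vsP /periodic_pointsP //].
by rewrite (fmorph_pchar iota) pchar_Fp.
Qed.
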